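(* Let $X$ be a Hausdorff space and $\gamma:X\times X\to\mathbb{R}$ a continuous conditionally negative definite kernel. For the kernel $G_{\gamma}:X\times X\to\mathbb{R}$, $G_{\gamma}(x,y)=e^{-\gamma(x,y)}$: $G_{\gamma}$ is strictly positive definite (SPD) if and only if $\gamma$ is metrizable; likewise, $G_{\gamma}$ is universal if and only if $\gamma$ is metrizable.
   Context: A kernel $\gamma:X\times X\to\mathbb{R}$ is conditionally negative definite (CND) if $\gamma(x,y)=\gamma(y,x)$ and $\sum_{\mu,\nu=1}^{n}c_{\mu}c_{\nu}\gamma(x_{\mu},x_{\nu})\le 0$ for all finitely many distinct points $x_{1},\dots,x_{n}$ and $c_{1},\dots,c_{n}\in\mathbb{R}$ with $\sum_{\mu}c_{\mu}=0$. Every CND kernel can be written $\gamma(x,y)=\|h(x)-h(y)\|^{2}_{\mathcal{H}}+f(x)+f(y)$ with $\mathcal{H}$ a real Hilbert space, $h:X\to\mathcal{H}$ and $f(x)=\gamma(x,x)/2$; $\gamma$ is called metrizable if $h$ is injective, equivalently if $2\gamma(x,y)>\gamma(x,x)+\gamma(y,y)$ for all $x\neq y$ in $X$. A kernel $K:X\times X\to\mathbb{C}$ is positive definite if $\sum_{\mu,\nu=1}^{n}c_{\mu}\overline{c_{\nu}}K(x_{\mu},x_{\nu})\ge 0$ for all finitely many distinct points $x_{\mu}\in X$ and scalars $c_{\mu}\in\mathbb{C}$, and strictly positive definite (SPD) if moreover the sum vanishes only when all $c_{\mu}=0$. Its reproducing kernel Hilbert space $\mathcal{H}_{K}$ is the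 Hilbert space of functions $F:X\to\mathbb{C}$ that contains $K_{y}:=K(\cdot,y)$ for every $y\in X$, satisfies $\langle F,K_{y}\rangle_{\mathcal{H}_{K}}=F(y)$, and in which $\mathrm{span}\{K_{y}:y\in X\}$ is dense. A positive definite kernel $K$ on a Hausdorff space $X$ is universal if $\mathcal{H}_{K}\subset C(X)$ and for every compact $\mathcal{C}\subset X$, continuous $g:\mathcal{C}\to\mathbb{C}$ and $\epsilon>0$ there is $f\in\mathcal{H}_{K}$ with $\sup_{x\in\mathcal{C}}|f(x)-g(x)|<\epsilon$. *)

(* Defs.v *)
From HB Require Import structures.
From mathcomp Require Import all_boot all_order all_algebra sesquilinear.
From mathcomp Require Import all_classical all_reals all_analysis.
From mathcomp Require Import complex.

Set Implicit Arguments.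
Unset Strict Implicit.
Unset Printing Implicit Defensive.

Import Order.TTheory GRing.Theory Num.Theory numFieldNormedType.Exports.

Local Open Scope classical_set_scope.
Local Open Scope ring_scope.
Local Open Scope complex_scope.

(* [theta] is the identity for real and the conjugation for complex scalars;
   [hdot] is linear in its first and [theta]-linear in its second argument. *)
Record hilbertSpace (K : numFieldType) (theta : K -> K) := HilbertSpace {
  hcarrier :> completeNormedModType K;
  hdot : {dot hcarrier for theta};
  hnormE : forall v : hcarrier, `|v| ^+ 2 = hdot v v }.

Definition lin_span (K : numFieldType) (V : lmodType K) (I : Type)
    (k : I -> V) : set V :=
  [set v | exists (n : nat) (y : 'I_n -> I) (c : 'I_n -> K),
     v = \sum_(i < n) c i *: k (y i)].

Definition cnd_kernel (R : realType) (X : Type) (gamma : X -> X -> R) : Prop :=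
  (forall x y, gamma x y = gamma y x) /\
  forall (n : nat) (x : 'I_n -> X) (c : 'I_n -> R),
    injective x -> \sum_i c i = 0 ->
    \sum_i \sum_j c i * c j * gamma (x i) (x j) <= 0.

Definition metrizable_kernel (R : realType) (X : Type) (gamma : X -> X -> R)
    : Prop :=
  exists (H : hilbertSpace (@idfun R)) (h : X -> H),
    (forall x y, gamma x y = `|h x - h y| ^+ 2 + gamma x x / 2 + gamma y y / 2) /\
    injective h.

(* In [R[i]], [0 <= z] means that [z] is real and nonnegative. *)
Definition pd_kernel (R : realType) (X : Type) (K : X -> X -> R[i]) : Prop :=
  forall (n : nat) (x : 'I_n -> X) (c : 'I_n -> R[i]), injective x ->
    0 <= \sum_i \sum_j c i * (c j)^* * K (x i) (x j).

Definition spd_kernel (R : realType) (X : Type) (K : X -> X -> R[i]) : Prop :=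
  pd_kernel K /\
  forall (n : nat) (x : 'I_n -> X) (c : 'I_n -> R[i]), injective x ->
    \sum_i \sum_j c i * (c j)^* * K (x i) (x j) = 0 -> forall i, c i = 0.

(* [R[i]^o] is [R[i]] with its usual topology. A Hilbert space of functions is
   a Hilbert space [H] with an injective linear map [ev] into the functions. *)
Definition is_rkhs (R : realType) (X : Type) (K : X -> X -> R[i])
    (H : hilbertSpace (@Num.conj R[i]))
    (ev : {linear H -> (X -> R[i]^o)}) : Prop :=
  injective ev /\
  exists k : X -> H,
    [/\ forall y, ev (k y) = (fun x => K x y),
        forall (F : H) (y : X), hdot H F (k y) = ev F y
      & dense (lin_span k)].

Definition universal_kernel (R : realType) (X : topologicalType)
    (K : X -> X -> R[i]) : Prop :=
  pd_kernel K /\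
  exists (H : hilbertSpace (@Num.conj R[i])) (ev : {linear H -> (X -> R[i]^o)}),
    [/\ is_rkhs K ev,
        forall F : H, continuous (ev F)
      & forall (C : set X) (g : X -> R[i]^o) (eps : R),
          compact C -> {within C, continuous g} -> 0 < eps ->
          exists F : H,
            (ereal_sup [set (complex.Re `|ev F x - g x|)%:E | x in C]
              < eps%:E)%E].

Definition complex_kernel (R : realType) (X : Type) (K : X -> X -> R)
    (x y : X) : R[i] := (K x y)%:C.

Definition exp_kernel (R : realType) (X : Type) (gamma : X -> X -> R)
    (x y : X) : R := expR (- gamma x y).

(* Main.v *)
(* If [gamma x y = |h x - h y|^2 + (gamma x x + gamma y y) / 2], then
   [exp (- gamma x y) = a x * a y * exp (2 <h x, h y>)] with [a > 0]. The kernel [exp (2 <u, v>)]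
   is positive definite on the whole Hilbert space (Schur products and limits), so for every
   vector [w], by Cauchy-Schwarz against the point [w / 2], the function [a * exp <h _, w>] is a
   bounded functional on finite combinations of kernel sections, and hence a uniform limit of
   such combinations on compact sets. The functions [exp <h _, w>] span an algebra which
   separates points when [h] is injective, so Stone-Weierstrass gives universality. Universality
   lets one interpolate arbitrary values at finitely many points, which makes the kernel strictly
   positive definite. Strict positivity at two points forces
   [2 gamma x y <> gamma x x + gamma y y], which is the injectivity of the canonical map [h] into
   the reproducing kernel Hilbert space of
   [(gamma x o + gamma o y - gamma x y - gamma o o) / 2].

   The reproducing kernel Hilbert space of [K] is realized as the space of functions [F] whose
   functional [sum_i c_i x_i |-> sum_i c_i^* F (x_i)] is a limit, for the norm given by [K], of
   functionals of finite combinations of the sections [K _ y]. *)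
Require Import Defs.
From HB Require Import structures.
From mathcomp Require Import all_boot all_order all_algebra sesquilinear.
From mathcomp Require Import all_classical all_reals all_analysis.
From mathcomp Require Import complex ring lra.
Import Order.TTheory GRing.Theory Num.Theory numFieldNormedType.Exports.

Set Implicit Arguments.
Unset Strict Implicit.
Unset Printing Implicit Defensive.

Local Open Scope classical_set_scope.
Local Open Scope ring_scope.

(** * Positive semidefinite forms on finite formal combinations *)

(** Restricting to [e <= 1] lets later error estimates absorb a term in [e ^+ 2] into a multiple of
    [e]. The order of [K] may be partial, so the minimum below needs comparability, which positive
    elements have. *)
Lemma le_all_eps (K : numFieldType) (c x : K) : 0 <= c ->
  (forall e, 0 < e -> e <= 1 -> x <= c * e) -> x <= 0.
Proof.
move=> c0 xc; apply/ler_addgt0Pr => e e0; rewrite add0r.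
have d0 : 0 < e / (c + 1) by rewrite divr_gt0// ltr_wpDl.
have d1 : (e / (c + 1) >=< 1)%O by rewrite real_comparable// gtr0_real.
have m0 : 0 < Num.min (e / (c + 1)) 1 by rewrite comparable_lt_min ?d0 ?ltr01.
have m1 : Num.min (e / (c + 1)) 1 <= 1 by rewrite comparable_ge_min// lexx orbT.
apply: (le_trans (xc _ m0 m1)).
apply: (@le_trans _ _ (c * (e / (c + 1)))).
  by rewrite ler_wpM2l// comparable_ge_min// lexx.
by rewrite mulrCA ger_pMr// ler_pdivrMr ?ltr_wpDl// mul1r lerDl.
Qed.

Lemma eq_all_eps (K : numFieldType) (c x y : K) : 0 <= c ->
  (forall e, 0 < e -> e <= 1 -> `|x - y| <= c * e) -> x = y.
Proof.
by move=> c0 /(le_all_eps c0); rewrite normr_le0 subr_eq0 => /eqP.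
Qed.

Section FormalCombinations.
Variables (K : numFieldType) (theta : {rmorphism K -> K}) (X : Type).
Implicit Types (k : X -> X -> K) (f g : X -> K) (s t : seq (K * X)).

(* A list [s] stands for a formal combination of points, possibly repeated; [kform k s t] is
   the inner product [<comb k s, comb k t>] of the reproducing kernel Hilbert space. *)
Definition comb k s : X -> K := fun x => \sum_(p <- s) p.1 * k x p.2.

(** By the reproducing property this is the inner product of [f] with the combination [s]; it makes
    sense for every function [f], before any Hilbert space is available. *)
Definition pairing f s := \sum_(p <- s) theta p.1 * f p.2.

Definition scale_comb (a : K) s := [seq (a * p.1, p.2) | p <- s].

Definition kform k s t := pairing (comb k s) t.

Definition psd_kernel k := forall s, 0 <= kform k s s.

Lemma comb_cat k s t x : comb k (s ++ t) x = comb k s x + comb k t x.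
Proof. by rewrite /comb big_cat. Qed.

Lemma comb_scale k a s x : comb k (scale_comb a s) x = a * comb k s x.
Proof.
by rewrite /comb big_map mulr_sumr; apply: eq_bigr => p _ /=; rewrite mulrA.
Qed.

Lemma comb_seq1 k a y x : comb k [:: (a, y)] x = a * k x y.
Proof. by rewrite /comb big_seq1. Qed.

Lemma comb_nil k x : comb k [::] x = 0.
Proof. by rewrite /comb big_nil. Qed.

Lemma pairing_cat f s t : pairing f (s ++ t) = pairing f s + pairing f t.
Proof. by rewrite /pairing big_cat. Qed.

Lemma pairing_scale f a s : pairing f (scale_comb a s) = theta a * pairing f s.
Proof.
rewrite /pairing big_map mulr_sumr; apply: eq_bigr => p _ /=.
by rewrite rmorphM mulrA.
Qed.

Lemma pairing_seq1 f x : pairing f [:: (1, x)] = f x.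
Proof. by rewrite /pairing big_seq1 rmorph1 mul1r. Qed.

Lemma eq_pairing f g s : f =1 g -> pairing f s = pairing g s.
Proof. by move=> fg; apply: eq_bigr => p _; rewrite fg. Qed.

Lemma pairingP a f g s :
  pairing (fun x => a * f x + g x) s = a * pairing f s + pairing g s.
Proof.
rewrite /pairing mulr_sumr -big_split; apply: eq_bigr => p _ /=.
by rewrite mulrDr mulrCA.
Qed.

Lemma pairingB f g s :
  pairing (fun x => f x - g x) s = pairing f s - pairing g s.
Proof.
rewrite (@eq_pairing _ (fun x => (-1) * g x + f x)) => [|x].
  by rewrite pairingP mulN1r addrC.
by rewrite mulN1r addrC.
Qed.

Lemma pairingD f g s :
  pairing (fun x => f x + g x) s = pairing f s + pairing g s.
Proof.
rewrite (@eq_pairing _ (fun x => 1 * f x + g x)) => [|x].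
  by rewrite pairingP mul1r.
by rewrite mul1r.
Qed.

Lemma kform_catl k s t u : kform k (s ++ t) u = kform k s u + kform k t u.
Proof. by rewrite /kform (eq_pairing _ (comb_cat k s t)) pairingD. Qed.

Lemma kform_scalel k a s u : kform k (scale_comb a s) u = a * kform k s u.
Proof.
rewrite /kform (eq_pairing _ (comb_scale k a s)).
rewrite (@eq_pairing _ (fun x => a * comb k s x + 0)) => [|x]; last first.
  by rewrite addr0.
by rewrite pairingP [X in _ + X]big1 ?addr0// => p _; rewrite mulr0.
Qed.

Lemma kform_catr k s t u : kform k s (t ++ u) = kform k s t + kform k s u.
Proof. exact: pairing_cat. Qed.

Lemma kform_scaler k a s u : kform k s (scale_comb a u) = theta a * kform k s u.
Proof. exact: pairing_scale. Qed.

Lemma kformE k s t :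
  kform k s t = \sum_(q <- t) \sum_(p <- s) p.1 * theta q.1 * k q.2 p.2.
Proof.
apply: eq_bigr => q _; rewrite mulr_sumr; apply: eq_bigr => p _.
by rewrite mulrCA mulrA.
Qed.

Hypothesis thetaK : involutive theta.

Lemma kform_sym k s t : (forall x y, k y x = theta (k x y)) ->
  kform k t s = theta (kform k s t).
Proof.
move=> kC; rewrite !kformE exchange_big rmorph_sum; apply: eq_bigr => q _ /=.
rewrite rmorph_sum; apply: eq_bigr => p _ /=.
by rewrite !rmorphM thetaK -kC (mulrC q.1).
Qed.

Hypothesis mul_theta : forall x : K, x * theta x = `|x| ^+ 2.

Lemma theta_ge0 x : 0 <= x -> theta x = x.
Proof.
rewrite le_eqVlt => /predU1P[<-|x0]; first by rewrite rmorph0.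
have := mul_theta x; rewrite (ger0_norm (ltW x0)) expr2.
by move/mulfI; apply; rewrite gt_eqF.
Qed.

(** The discriminant argument, stated for bare coefficients so that it serves formal combinations,
    Hilbert space vectors, and almost minimizers, for which [a] is an error and not a squared
    norm. *)
Lemma cauchy_schwarz_coef (a b c : K) : 0 <= b ->
  (forall l, 0 <= a + l * theta c + theta l * c + l * theta l * b) ->
  `|c| ^+ 2 <= a * b.
Proof.
rewrite le_eqVlt => /predU1P[<- H|b0 H].
  rewrite mulr0; have a0 : 0 <= a.
    by have := H 0; rewrite rmorph0 !mul0r !addr0.
  have [/eqP ->|c0] := boolP (c == 0); first by rewrite normr0 expr0n.
  have q0 : 0 < `|c| ^+ 2 by rewrite exprn_gt0// normr_gt0.
  have t0 : 0 <= (a + 1) / `|c| ^+ 2 by rewrite divr_ge0 ?addr_ge0// ltW.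
  (* With [b = 0] the expression is affine along multiples of [c]; this multiple brings it down to
     [- (a + 2)]. *)
  have := H (- ((a + 1) / `|c| ^+ 2) * c).
  rewrite rmorphM rmorphN (theta_ge0 t0); set t := (a + 1) / _.
  have -> : a + - t * c * theta c + - t * theta c * c
      + - t * c * (- t * theta c) * 0 = a - 2 * (t * (c * theta c)) by ring.
  rewrite mul_theta /t divfK ?gt_eqF// (_ : _ - _ = - (a + 2)); last by ring.
  by rewrite oppr_ge0 lt_geF// ltr_wpDl.
(* This is the minimizer of the quadratic expression in [l]. *)
have := H (- c / b).
rewrite !rmorphM fmorphV rmorphN (theta_ge0 (ltW b0)).
have -> : a + - c / b * theta c + - theta c / b * c + - c / b * (- theta c / b) * b
   = a - (c * theta c) / b.
  by field; rewrite gt_eqF.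
by rewrite mul_theta subr_ge0 ler_pdivrMr.
Qed.

Lemma kform_cauchy_schwarz k s t : (forall x y, k y x = theta (k x y)) ->
  psd_kernel k -> `|kform k s t| ^+ 2 <= kform k s s * kform k t t.
Proof.
move=> kC kpsd; apply: cauchy_schwarz_coef => // l.
have := kpsd (s ++ scale_comb l t).
rewrite kform_catl kform_scalel !kform_catr !kform_scaler (kform_sym s t kC).
by congr (0 <= _); ring.
Qed.

End FormalCombinations.

(** * Reproducing kernel Hilbert spaces *)

(* The common features of the reals with the identity and of the complexes with conjugation. *)
Record scalarField := ScalarField {
  scalar_sort :> numFieldType;
  sconj : {rmorphism scalar_sort -> scalar_sort};
  sconjK : involutive sconj;
  mul_sconj : forall x, x * sconj x = `|x| ^+ 2;
  ssqrt : scalar_sort -> scalar_sort;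
  ssqrt_ge0 : forall x, 0 <= ssqrt x;
  sqr_ssqrt : forall x, 0 <= x -> ssqrt x ^+ 2 = x;
  scalar_complete : forall F : set_system scalar_sort,
    ProperFilter F -> cauchy F -> cvg F }.

Record psdKernel := PsdKernel {
  pk_scalar : scalarField;
  pk_index : Type;
  pk_fun :> pk_index -> pk_index -> pk_scalar;
  pk_sym : forall x y, pk_fun y x = sconj pk_scalar (pk_fun x y);
  pk_psd : psd_kernel (sconj pk_scalar) pk_fun }.

Arguments pk_fun : clear implicits.

Section Rkhs.
Variable D : psdKernel.
Local Notation K := (scalar_sort (pk_scalar D)).
Local Notation theta := (sconj (pk_scalar D)).
Local Notation X := (pk_index D).
Local Notation comb := (comb (pk_fun D)).
Local Notation pairing := (pairing theta).
Local Notation form := (kform theta (pk_fun D)).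
Implicit Types (f g : X -> K) (s t v w : seq (K * X)) (e M : K).

Definition comb_norm s : K := ssqrt (form s s).

Lemma comb_norm_ge0 s : 0 <= comb_norm s.
Proof. exact: ssqrt_ge0. Qed.

Lemma sqr_comb_norm s : comb_norm s ^+ 2 = form s s.
Proof. by rewrite sqr_ssqrt//; exact: pk_psd. Qed.

Lemma form_sym s t : form t s = theta (form s t).
Proof. by apply: kform_sym; [exact: sconjK|exact: pk_sym]. Qed.

Lemma form_le s t : `|form s t| <= comb_norm s * comb_norm t.
Proof.
rewrite -(@ler_pXn2r _ 2) ?nnegrE ?mulr_ge0 ?comb_norm_ge0//.
rewrite exprMn !sqr_comb_norm; apply: kform_cauchy_schwarz.
- exact: sconjK.
- exact: mul_sconj.
- exact: pk_sym.
- exact: pk_psd.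
Qed.

(** A dual way to say that [f] has norm at most [e], usable before the norm of the space exists. *)
Definition bounded_by f e := forall s, `|pairing f s| <= e * comb_norm s.

Lemma bounded_byB f g d e : bounded_by f d -> bounded_by g e ->
  bounded_by (fun x => f x - g x) (d + e).
Proof.
move=> fd ge s; rewrite pairingB mulrDl (le_trans (ler_normB _ _))//.
by rewrite lerD.
Qed.

Lemma bounded_byP a f g d e : bounded_by f d -> bounded_by g e ->
  bounded_by (fun x => a * f x + g x) (`|a| * d + e).
Proof.
move=> fd ge s; rewrite pairingP mulrDl (le_trans (ler_normD _ _))// lerD//.
by rewrite normrM -mulrA ler_wpM2l.
Qed.

Lemma bounded_comb s : bounded_by (comb s) (comb_norm s).
Proof. exact: form_le. Qed.

(** Testing the functional on [s] itself gives the square of [comb_norm s]. *)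
Lemma comb_norm_le s e : 0 <= e -> bounded_by (comb s) e -> comb_norm s <= e.
Proof.
move=> e0 /(_ s); rewrite -[pairing _ _]/(form s s) -sqr_comb_norm.
rewrite ger0_norm ?exprn_ge0 ?comb_norm_ge0// expr2.
have := comb_norm_ge0 s; rewrite le_eqVlt => /predU1P[<- //|s0].
by rewrite ler_pM2r.
Qed.

(** The completion is realized inside the functions: combinations at distance zero define the same
    function, so no quotient is taken. *)
Definition approximable : {pred X -> K^o} :=
  fun f => `[< forall e, 0 < e ->
    exists s, bounded_by (fun x => f x - comb s x) e >].

Lemma approximable_submod : GRing.submod_closed approximable.
Proof.
split=> [|a f g /asboolP fA /asboolP gA]; apply/asboolP => e e0.
  exists [::] => s; rewrite (@eq_pairing _ _ _ _ (fun=> 0)); last first.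
    by move=> x; rewrite comb_nil subr0.
  rewrite /pairing big1 ?normr0 ?mulr_ge0 ?comb_norm_ge0 ?ltW// => p _.
  by rewrite mulr0.
have d0 : 0 < e / (`|a| + 1) by rewrite divr_gt0// ltr_wpDl.
have [s fs] := fA _ d0; have [t gt] := gA _ d0.
exists (scale_comb a s ++ t) => w.
rewrite (@eq_pairing _ _ _ _
  (fun x => a * (f x - comb s x) + (g x - comb t x))); last first.
  move=> x; rewrite comb_cat comb_scale mulrBr opprD addrACA.
  by congr (_ + _).
have := bounded_byP a fs gt w.
rewrite (_ : `|a| * (e / (`|a| + 1)) + e / (`|a| + 1) = e)//.
by field; rewrite gt_eqF// ltr_wpDl.
Qed.

HB.instance Definition _ :=
  GRing.isSubmodClosed.Build K (X -> K^o) approximable approximable_submod.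

Record rkhs := Rkhs { rkhs_fun :> X -> K^o; _ : rkhs_fun \in approximable }.

HB.instance Definition _ := [isSub for rkhs_fun].
HB.instance Definition _ := [Choice of rkhs by <:].
HB.instance Definition _ := [SubChoice_isSubLmodule of rkhs by <:].

Local Notation H := rkhs.
Implicit Types F G : H.

Lemma rkhs_approx F e : 0 < e ->
  exists s, bounded_by (fun x => F x - comb s x) e.
Proof. by case: F => f /= /asboolP; apply. Qed.

Lemma rkhs_bounded F : exists2 M, 0 <= M & bounded_by F M.
Proof.
have [s Fs] := rkhs_approx F ltr01.
exists (1 + comb_norm s); first by rewrite addr_ge0// comb_norm_ge0.
move=> t; have := @bounded_byP 1 _ _ _ _ Fs (@bounded_comb s) t.
by rewrite normr1 mul1r; under eq_pairing do rewrite mul1r subrK.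
Qed.

Lemma comb_approximable s : (comb s : X -> K^o) \in approximable.
Proof.
apply/asboolP => e e0; exists s => t.
rewrite (@eq_pairing _ _ _ _ (fun=> 0)) => [|x]; last by rewrite subrr.
rewrite /pairing big1 ?normr0 ?mulr_ge0 ?comb_norm_ge0 ?ltW// => p _.
by rewrite mulr0.
Qed.

Definition rkhs_comb s : H := Rkhs (comb_approximable s).

(* [<F, G>] is the limit of the pairings of [F] with combinations approximating [G]. *)
Definition dot_filter F G : set_system K :=
  filter_from [set e : K | 0 < e] (fun e =>
    [set pairing F s | s in [set s | bounded_by (fun x => G x - comb s x) e]]).

(** The formal difference of two approximants of [g] has norm at most [d + e]. This is what makes
    [dot_filter] Cauchy. *)
Lemma pairing_approx_dist f g M s t d e : 0 <= M -> bounded_by f M ->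
  bounded_by (fun x => g x - comb s x) d ->
  bounded_by (fun x => g x - comb t x) e -> 0 <= d -> 0 <= e ->
  `|pairing f s - pairing f t| <= M * (d + e).
Proof.
move=> M0 fM gs gt d0 e0.
have -> : pairing f s - pairing f t = pairing f (s ++ scale_comb (-1) t).
  by rewrite pairing_cat pairing_scale rmorphN rmorph1 mulN1r.
rewrite (le_trans (fM _))// ler_wpM2l// comb_norm_le ?addr_ge0// => u.
have := bounded_byB gt gs u; rewrite addrC; congr (`|_| <= _).
by apply: eq_pairing => x; rewrite comb_cat comb_scale; ring.
Qed.

Lemma dot_filter_proper F G : ProperFilter (dot_filter F G).
Proof.
apply: filter_from_proper; last first.
  move=> e e0; have [s Gs] := rkhs_approx G e0.
  by exists (pairing F s), s.
apply: filter_from_filter; first by exists 1 => /=.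
move=> d e /= d0 e0; exists (Num.min d e) => /=.
  by rewrite comparable_lt_min ?d0// real_comparable// gtr0_real.
have de : (d >=< e)%O by rewrite real_comparable// gtr0_real.
move=> _ [s Gs <-]; split; exists s => // t; apply: (le_trans (Gs t)).
- by rewrite ler_wpM2r ?comb_norm_ge0// comparable_ge_min// lexx.
- by rewrite ler_wpM2r ?comb_norm_ge0// comparable_ge_min// lexx orbT.
Qed.

Lemma dot_filter_cvg F G : cvg (dot_filter F G).
Proof.
have PF := dot_filter_proper F G.
apply: scalar_complete; apply: cauchy_exP => e e0.
have [M M0 FM] := rkhs_bounded F.
(* The factor 2 accounts for the two approximants; [M + 1] is nonzero and makes the final inequality
   strict. *)
have d0 : 0 < e / (2 * (M + 1)) by rewrite divr_gt0// mulr_gt0// ltr_wpDl.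
have [s Gs] := rkhs_approx G d0.
exists (pairing F s), (e / (2 * (M + 1))) => // _ [t Gt <-].
rewrite -ball_normE /ball_/=.
apply: (le_lt_trans (pairing_approx_dist M0 FM Gs Gt (ltW d0) (ltW d0))).
rewrite (_ : M * _ = M / (M + 1) * e); last by field; rewrite gt_eqF ?ltr_wpDl.
by rewrite gtr_pMl// ltr_pdivrMr ?ltr_wpDl// mul1r ltrDl.
Qed.

Definition rkhs_dot F G : K := lim (dot_filter F G).

(** Any approximant of [G] computes the inner product, with an explicit error. The algebraic laws of
    [rkhs_dot] are proved on combinations and transferred through this estimate. *)
Lemma rkhs_dotP F G M s e : bounded_by F M ->
  bounded_by (fun x => G x - comb s x) e -> 0 <= M -> 0 <= e ->
  `|rkhs_dot F G - pairing F s| <= M * e.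
Proof.
move=> FM Gs M0 e0; apply/ler_addgt0Pr => d d0.
have PF := dot_filter_proper F G.
have d'0 : 0 < d / (M + 1) by rewrite divr_gt0// ltr_wpDl.
have [r /= r0 near_dot] : dot_filter F G (ball (rkhs_dot F G) (d / (M + 1))).
  exact: (dot_filter_cvg (nbhsx_ballx _ _ d'0)).
have rd : (r >=< d / (M + 1))%O by rewrite real_comparable// gtr0_real.
(* An approximant [t] this fine is both in the set of the filter where the limit is nearly attained
   and close enough to [s]; the errors add up to [M * e + d]. *)
have m0 : 0 < Num.min r (d / (M + 1)).
  by rewrite comparable_lt_min ?r0.
have [t Gt] := rkhs_approx G m0.
have Gtr : bounded_by (fun x => G x - comb t x) r.
  move=> u; rewrite (le_trans (Gt u))// ler_wpM2r ?comb_norm_ge0//.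
  by rewrite comparable_ge_min// lexx.
have Gtd : bounded_by (fun x => G x - comb t x) (d / (M + 1)).
  move=> u; rewrite (le_trans (Gt u))// ler_wpM2r ?comb_norm_ge0//.
  by rewrite comparable_ge_min// lexx orbT.
have : ball (rkhs_dot F G) (d / (M + 1)) (pairing F t).
  by apply: near_dot; exists t.
rewrite -ball_normE/= => /ltW zt.
rewrite (le_trans (ler_distD (pairing F t) _ _))//.
have := lerD zt (pairing_approx_dist M0 FM Gtd Gs (ltW d'0) e0).
move=> /le_trans; apply; rewrite le_eqVlt; apply/orP; left; apply/eqP.
by field; rewrite gt_eqF// ltr_wpDl.
Qed.

Lemma norm_sconj (x : K) : `|theta x| = `|x|.
Proof.
apply/eqP; rewrite -(@eqrXn2 _ 2)// -!mul_sconj sconjK mulrC.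
exact/eqP.
Qed.

(** A combination approximates itself with error 0. *)
Lemma rkhs_dot_comb F s : rkhs_dot F (rkhs_comb s) = pairing F s.
Proof.
have [M M0 FM] := rkhs_bounded F.
apply: (@eq_all_eps _ 0) => // e e0 _.
rewrite mul0r -(mulr0 M); apply: (rkhs_dotP FM) => // t.
rewrite mul0r (@eq_pairing _ _ _ _ (fun=> 0)) => [|x]; last exact: subrr.
by rewrite /pairing big1 ?normr0// => p _; rewrite mulr0.
Qed.

Lemma rkhs_dotPl a F G E :
  rkhs_dot (a *: F + G) E = a * rkhs_dot F E + rkhs_dot G E.
Proof.
have [M M0 FM] := rkhs_bounded F; have [N N0 GN] := rkhs_bounded G.
have aFG : bounded_by (a *: F + G : H) (`|a| * M + N).
  exact: (bounded_byP a FM GN).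
have A0 : 0 <= `|a| * M + N by rewrite addr_ge0// mulr_ge0.
apply: (@eq_all_eps _ ((`|a| * M + N) + (`|a| * M + N))) => [|e e0 _].
  by rewrite addr_ge0.
have [s Es] := rkhs_approx E e0; have e0' := ltW e0.
have := rkhs_dotP FM Es M0 e0'; have := rkhs_dotP GN Es N0 e0'.
have := rkhs_dotP aFG Es A0 e0'.
rewrite (pairingP theta a F G s : pairing (a *: F + G : H) s = _).
set z := rkhs_dot _ _; set x := rkhs_dot F E; set y := rkhs_dot G E.
set p := pairing _ _; set q := pairing _ _ => Hz Hy Hx.
rewrite (_ : z - _ = (z - (a * p + q)) - (a * (x - p) + (y - q))); last by ring.
rewrite mulrDl (le_trans (ler_normB _ _))// lerD//.
rewrite mulrDl (le_trans (ler_normD _ _))// lerD//.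
by rewrite normrM -mulrA ler_wpM2l.
Qed.

Lemma comb_norm_approx F M s e : 0 <= M -> bounded_by F M -> 0 <= e ->
  bounded_by (fun x => F x - comb s x) e -> comb_norm s <= M + e.
Proof.
move=> M0 FM e0 Fs; apply: comb_norm_le => [|t]; first by rewrite addr_ge0.
have := bounded_byB FM Fs t; congr (`|_| <= _).
by apply: eq_pairing => x; rewrite opprB addrC subrK.
Qed.

Lemma rkhs_dot_le F G M N : 0 <= M -> 0 <= N -> bounded_by F M ->
  bounded_by G N -> `|rkhs_dot F G| <= M * N.
Proof.
move=> M0 N0 FM GN; rewrite -subr_le0.
apply: (@le_all_eps _ (M + M)) => [|e e0 _]; first by rewrite addr_ge0.
have [s Gs] := rkhs_approx G e0; have e0' := ltW e0.
have Hd := rkhs_dotP FM Gs M0 e0'.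
have Hp : `|pairing F s| <= M * (N + e).
  by rewrite (le_trans (FM s))// ler_wpM2l// (comb_norm_approx N0 GN).
rewrite -(subrK (pairing F s) (rkhs_dot F G)) lerBlDr.
rewrite (le_trans (ler_normD _ _))// (le_trans (lerD Hd Hp))//.
by rewrite le_eqVlt; apply/orP; left; apply/eqP; ring.
Qed.

Lemma rkhs_dot_combl t F : rkhs_dot (rkhs_comb t) F = theta (pairing F t).
Proof.
apply: (@eq_all_eps _ (comb_norm t + comb_norm t)) => [|e e0 _].
  by rewrite addr_ge0// comb_norm_ge0.
have [s Fs] := rkhs_approx F e0.
have := @rkhs_dotP (rkhs_comb t) F _ s e (@bounded_comb t) Fs (comb_norm_ge0 t)
  (ltW e0).
rewrite -[pairing _ _]/(form t s) (form_sym s t) => H1.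
rewrite -(subrK (theta (form s t)) (rkhs_dot _ _)) -addrA -rmorphB mulrDl.
rewrite (le_trans (ler_normD _ _))// lerD// norm_sconj -normrN opprB.
by rewrite -pairingB mulrC.
Qed.

(** Replacing [G] by a combination [t] reduces the claim to [rkhs_dot_combl]; the remainder [G - t]
    is controlled on one side by [rkhs_dotP], on the other by [rkhs_dot_le]. *)
Lemma rkhs_dot_sym F G : rkhs_dot G F = theta (rkhs_dot F G).
Proof.
have [M M0 FM] := rkhs_bounded F.
apply: (@eq_all_eps _ (M + M)) => [|e e0 _]; first by rewrite addr_ge0.
have [t Gt] := rkhs_approx G e0.
have H1 := rkhs_dotP FM Gt M0 (ltW e0).
have H2 : `|rkhs_dot (-1 *: rkhs_comb t + G) F| <= e * M.
  apply: (rkhs_dot_le (ltW e0) M0) => // s.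
  have := Gt s; congr (`|_| <= _); apply: eq_pairing => x.
  by rewrite addrC -[in LHS]scaleN1r.
move: H2; rewrite rkhs_dotPl rkhs_dot_combl mulN1r addrC => H2.
rewrite -(subrK (theta (pairing F t)) (rkhs_dot G F)) -addrA -rmorphB mulrDl.
rewrite (le_trans (ler_normD _ _))// lerD//; first by rewrite mulrC.
by rewrite norm_sconj distrC.
Qed.

Lemma rkhs_dot_ge0 F : 0 <= rkhs_dot F F.
Proof.
(* A scalar equal to its modulus is nonnegative; this turns the claim into an equation, which can be
   proved up to small errors. *)
suff <- : `|rkhs_dot F F| = rkhs_dot F F by [].
have [M M0 FM] := rkhs_bounded F.
(* [M] is the cost of replacing the second argument by a combination [s], and [M + 1] that of
   replacing the first, since [comb_norm s <= M + e <= M + 1]. *)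
set c := M + (M + 1); have c0 : 0 <= c by rewrite !addr_ge0.
apply: (@eq_all_eps _ (c + c)) => [|e e0 e1]; first by rewrite addr_ge0.
have [s Fs] := rkhs_approx F e0; have e0' := ltW e0.
have zs : `|rkhs_dot F F - form s s| <= c * e.
  rewrite -(subrK (pairing F s) (rkhs_dot F F)) -addrA mulrDl.
  rewrite (le_trans (ler_normD _ _))// lerD//; first exact: rkhs_dotP.
  rewrite -pairingB (le_trans (Fs s))// mulrC ler_wpM2r//.
  by rewrite (le_trans (comb_norm_approx M0 FM e0' Fs))// lerD2l.
have f0 : `|form s s| = form s s by rewrite ger0_norm// pk_psd.
rewrite -(subrK (form s s) `|rkhs_dot F F|) -addrA mulrDl.
rewrite (le_trans (ler_normD _ _))// lerD//; last by rewrite distrC.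
by rewrite -{1}f0 (le_trans _ zs)// ler_dist_dist.
Qed.

Definition rkhs_norm F : K := ssqrt (rkhs_dot F F).

Lemma rkhs_norm_ge0 F : 0 <= rkhs_norm F.
Proof. exact: ssqrt_ge0. Qed.

Lemma sqr_rkhs_norm F : rkhs_norm F ^+ 2 = rkhs_dot F F.
Proof. by rewrite sqr_ssqrt// rkhs_dot_ge0. Qed.

Lemma rkhs_dotPr a F G E :
  rkhs_dot E (a *: F + G) = theta a * rkhs_dot E F + rkhs_dot E G.
Proof.
by rewrite rkhs_dot_sym rkhs_dotPl rmorphD rmorphM -!rkhs_dot_sym.
Qed.

Lemma rkhs_cauchy_schwarz F G :
  `|rkhs_dot F G| <= rkhs_norm F * rkhs_norm G.
Proof.
rewrite -(@ler_pXn2r _ 2) ?nnegrE ?mulr_ge0 ?rkhs_norm_ge0//.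
rewrite exprMn !sqr_rkhs_norm.
apply: (cauchy_schwarz_coef (@mul_sconj _)) => [|l]; first exact: rkhs_dot_ge0.
have := rkhs_dot_ge0 (l *: G + F).
rewrite rkhs_dotPl !rkhs_dotPr (rkhs_dot_sym F G).
by congr (0 <= _); ring.
Qed.

(** Together with [rkhs_norm_le] this identifies the norm with the least bound in [bounded_by]. *)
Lemma rkhs_norm_bound F : bounded_by F (rkhs_norm F).
Proof.
move=> s; rewrite -rkhs_dot_comb.
suff -> : comb_norm s = rkhs_norm (rkhs_comb s) by exact: rkhs_cauchy_schwarz.
by rewrite /rkhs_norm rkhs_dot_comb.
Qed.

Lemma rkhs_norm_le F e : 0 <= e -> bounded_by F e -> rkhs_norm F <= e.
Proof.
move=> e0 Fe; rewrite -(@ler_pXn2r _ 2) ?nnegrE ?rkhs_norm_ge0//.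
rewrite sqr_rkhs_norm expr2 -[leLHS]ger0_norm ?rkhs_dot_ge0//.
exact: rkhs_dot_le.
Qed.

Lemma rkhs_ext F G : F =1 G -> F = G.
Proof. by move=> FG; apply: val_inj; exact: funext. Qed.

Lemma rkhs_normD F G : rkhs_norm (F + G) <= rkhs_norm F + rkhs_norm G.
Proof.
apply: rkhs_norm_le => [|s]; first by rewrite addr_ge0 ?rkhs_norm_ge0.
have := bounded_byP 1 (@rkhs_norm_bound F) (@rkhs_norm_bound G) s.
rewrite normr1 mul1r; congr (`|_| <= _); apply: eq_pairing => x.
by rewrite mul1r.
Qed.

Lemma rkhs_normZ a F : rkhs_norm (a *: F) = `|a| * rkhs_norm F.
Proof.
apply/eqP; rewrite -(@eqrXn2 _ 2) ?mulr_ge0 ?rkhs_norm_ge0//.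
rewrite exprMn !sqr_rkhs_norm -mul_sconj -[a *: F]addr0 rkhs_dotPl rkhs_dotPr.
have d0 E : rkhs_dot 0 E = 0.
  have := rkhs_dotPl 1 0 0 E; rewrite scale1r addr0 mul1r => /eqP.
  by rewrite -subr_eq0 opprD addrA subrr sub0r oppr_eq0 => /eqP.
by rewrite d0 (rkhs_dot_sym 0) d0 rmorph0 !addr0 mulrA.
Qed.

Lemma rkhs_norm0_eq0 F : rkhs_norm F = 0 -> F = 0.
Proof.
move=> F0; apply: rkhs_ext => x; have := @rkhs_norm_bound F [:: (1, x)].
by rewrite F0 mul0r normr_le0 pairing_seq1 => /eqP.
Qed.

HB.instance Definition _ := Lmodule_isNormed.Build K rkhs
  rkhs_normD rkhs_normZ rkhs_norm0_eq0.

(** Evaluations are bounded functionals, so [U] converges pointwise to some [phi]. The Cauchy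
    estimates survive the pointwise limit, which shows both that [phi] is approximable and that the
    convergence holds in norm. *)
Lemma rkhs_complete (U : set_system H) : ProperFilter U -> cauchy U -> cvg U.
Proof.
move=> PU /cauchyP Ucauchy.
pose ev (x : X) (f : H) : K := f x.
have ev_cvg x : cvg (ev x @ U).
  apply: scalar_complete; apply: cauchy_exP => e e0.
  pose N := comb_norm [:: (1, x)].
  have N0 : 0 < N + 1 by rewrite ltr_wpDl// comb_norm_ge0.
  have [G UG] := Ucauchy _ (divr_gt0 e0 N0).
  exists (G x); change (U (ev x @^-1` ball (G x : K) e)).
  apply: filterS UG => f; rewrite /preimage/= -!ball_normE/= => Gf.
  have := @rkhs_norm_bound (G - f) [:: (1, x)].
  rewrite pairing_seq1 => /le_lt_trans; apply.
  apply: (@le_lt_trans _ _ (e / (N + 1) * N)).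
    by rewrite ler_wpM2r ?comb_norm_ge0// ltW.
  by rewrite mulrAC ltr_pdivrMr// ltr_pM2l// ltrDl.
pose phi x : K := lim (ev x @ U).
have phi_cvg s : pairing f s @[f --> U] --> pairing phi s.
  rewrite /pairing; elim: s => [|p s IHs].
    by under eq_fun do rewrite big_nil; rewrite big_nil; exact: cvg_cst.
  under eq_fun do rewrite big_cons; rewrite big_cons.
  by apply: cvgD => //; apply: cvgMr; exact: ev_cvg.
(* For fixed [s], let [g] tend to [phi] along [U] in the bound on the pairing of [g - f] with [s];
   how close [g] must be depends on [s], but the resulting bound does not. *)
have near_phi e : 0 < e ->
    \forall f \near U, bounded_by (fun x => phi x - (f : H) x) e.
  move=> e0; have e20 : 0 < e / 2 by rewrite divr_gt0.
  have [G UG] := Ucauchy _ e20.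
  apply: (filterS _ UG) => f; rewrite -ball_normE/= => Gf s.
  apply/ler_addgt0Pr => d d0; rewrite pairingB.
  have near_g : \forall g \near U, `|pairing phi s - pairing (g : H) s| < d.
    by move/cvgrPdist_lt : (phi_cvg s); exact.
  have [g [/= phig]] := filter_ex (filterI near_g UG).
  rewrite -ball_normE/= => Gg.
  have gf : rkhs_norm (g - f) <= e.
    rewrite -[rkhs_norm _]/`|g - f| (splitr e).
    by rewrite (le_trans (ler_distD G _ _))// lerD// ltW// distrC.
  rewrite -(subrK (pairing g s) (pairing phi s)) -addrA addrC.
  rewrite (le_trans (ler_normD _ _))// lerD//; last exact: ltW.
  rewrite -pairingB (le_trans (@rkhs_norm_bound (g - f) s))//.
  by rewrite ler_wpM2r ?comb_norm_ge0.
have phiH : (phi : X -> K^o) \in approximable.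
  apply/asboolP => e e0; have e20 : 0 < e / 2 by rewrite divr_gt0.
  have [f fe] := filter_ex (near_phi _ e20).
  have [s fs] := rkhs_approx f e20; exists s => t.
  have := bounded_byP 1 fe fs t.
  rewrite normr1 mul1r -splitr; congr (`|_| <= _).
  by apply: eq_pairing => x; rewrite mul1r addrA subrK.
apply/cvg_ex; exists (Rkhs phiH); apply/cvgrPdist_le => e e0.
apply: filterS (near_phi _ e0) => f fe.
exact: (rkhs_norm_le (ltW e0)).
Qed.

HB.instance Definition _ := Uniform_isComplete.Build rkhs rkhs_complete.

Lemma rkhs_dot_linearl G : GRing.linear_for *%R (rkhs_dot^~ G).
Proof. by move=> a E F; rewrite rkhs_dotPl. Qed.

Lemma rkhs_dot_linearr G : GRing.linear_for (theta \; *%R) (rkhs_dot G).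
Proof. by move=> a E F; rewrite rkhs_dotPr. Qed.

HB.instance Definition _ := @bilinear_isBilinear.Build K rkhs rkhs K
  *%R (theta \; *%R) rkhs_dot (pair rkhs_dot_linearl rkhs_dot_linearr).

Lemma rkhs_dot_hermitian F G :
  rkhs_dot F G = (-1) ^+ false * theta (rkhs_dot G F).
Proof. by rewrite expr0 mul1r rkhs_dot_sym. Qed.

HB.instance Definition _ := @isHermitianSesquilinear.Build K rkhs false theta
  rkhs_dot rkhs_dot_hermitian.

Lemma rkhs_dot_gt0 F : F != 0 -> 0 < rkhs_dot F F.
Proof.
move=> F0; rewrite -sqr_rkhs_norm exprn_gt0// lt_neqAle rkhs_norm_ge0 andbT.
by rewrite eq_sym; apply: contra F0 => /eqP/rkhs_norm0_eq0 ->.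
Qed.

HB.instance Definition _ := @isDotProduct.Build K rkhs rkhs_dot rkhs_dot_gt0.

Definition rkhs_hilbert : hilbertSpace theta :=
  HilbertSpace (hdot := rkhs_dot : {dot rkhs for theta}) sqr_rkhs_norm.

Lemma rkhs_fun_linear : linear (rkhs_fun : rkhs -> (X -> K^o)).
Proof. by []. Qed.

HB.instance Definition _ := GRing.isLinear.Build K rkhs (X -> K^o) *:%R
  (@rkhs_fun) rkhs_fun_linear.

Definition rkhs_eval : {linear rkhs -> (X -> K^o)} := @rkhs_fun.

Definition rkhs_point y : rkhs := rkhs_comb [:: (1, y)].

Lemma rkhs_pointE y x : rkhs_point y x = pk_fun D x y.
Proof. by rewrite /= comb_seq1 mul1r. Qed.

Lemma rkhs_reproducing F y : rkhs_dot F (rkhs_point y) = F y.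
Proof. by rewrite rkhs_dot_comb pairing_seq1. Qed.

Lemma rkhs_comb_span s : lin_span rkhs_point (rkhs_comb s).
Proof.
exists (size s), (fun i => (tnth (in_tuple s) i).2),
  (fun i => (tnth (in_tuple s) i).1).
apply: rkhs_ext => x.
have fun_sum n (E : 'I_n -> rkhs) : (\sum_i E i) x = \sum_i E i x :> K.
  exact: (big_morph (fun F : rkhs => F x : K)).
rewrite fun_sum /= /comb [LHS]big_tnth; apply: eq_bigr => i _.
by rewrite -rkhs_pointE.
Qed.

Lemma rkhs_dense : dense (lin_span rkhs_point).
Proof.
move=> O [F OF] Oopen; have /nbhs_ballP[e /= e0 eO] : nbhs F O.
  exact: open_nbhs_nbhs.
have e20 : 0 < e / 2 by rewrite divr_gt0.
have [s Fs] := rkhs_approx F e20.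
exists (rkhs_comb s); split; last exact: rkhs_comb_span.
apply: eO; rewrite -ball_normE/=; apply: (@le_lt_trans _ _ (e / 2)).
  exact: (rkhs_norm_le (ltW e20)).
by rewrite [ltRHS]splitr ltrDl.
Qed.

Lemma rkhs_inj : injective (@rkhs_fun).
Proof. by move=> F G FG; apply: rkhs_ext => x; rewrite FG. Qed.

(** The difference of two evaluations is the pairing with a two-point combination, whose squared
    norm is the second factor. Continuity of the kernel thus passes to the members of the space. *)
Lemma rkhs_eval_dist F x y :
  `|F x - F y| ^+ 2 <= `|F| ^+ 2 *
    (pk_fun D x x + pk_fun D y y - pk_fun D x y - pk_fun D y x).
Proof.
have -> : pk_fun D x x + pk_fun D y y - pk_fun D x y - pk_fun D y x =
    comb_norm [:: (1, x); (-1, y)] ^+ 2.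
  rewrite sqr_comb_norm kformE !big_cons !big_nil /= rmorphN rmorph1; ring.
rewrite -exprMn ler_pXn2r ?nnegrE ?mulr_ge0 ?comb_norm_ge0//.
have := @rkhs_norm_bound F [:: (1, x); (-1, y)].
by rewrite /pairing !big_cons big_nil /= rmorphN rmorph1 addr0 mul1r mulN1r.
Qed.

End Rkhs.

(** * Real and complex scalars *)

Section ScalarFields.
Variable R : realType.

Lemma real_mul_idfun (x : R) : x * idfun x = `|x| ^+ 2.
Proof. by rewrite real_normK ?num_real// expr2. Qed.

Definition real_scalar : scalarField :=
  @ScalarField R (idfun : {rmorphism R -> R}) (fun=> erefl) real_mul_idfun
    (@Num.sqrt R) (@sqrtr_ge0 R) (@sqr_sqrtr R) (@R_complete R).

(** The modulus makes the value nonnegative for every [z], as [ssqrt_ge0] demands, and changes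
    nothing when [0 <= z]. *)
Definition csqrt (z : R[i]) : R[i] := sqrtC `|z|.

Lemma csqrt_ge0 z : 0 <= csqrt z.
Proof. by rewrite sqrtC_ge0. Qed.

Lemma sqr_csqrt z : 0 <= z -> csqrt z ^+ 2 = z.
Proof. by move=> z0; rewrite sqrtCK ger0_norm. Qed.

Lemma complex_mul_conj (z : R[i]) : z * Num.conj z = `|z| ^+ 2.
Proof. by rewrite normCK. Qed.

Lemma ler_norm_Re_Im (z : R[i]) :
  `|z| <= (`|complex.Re z| + `|complex.Im z|)%:C%C.
Proof.
rewrite {1}(complexE z) rmorphD/= (le_trans (ler_normD _ _))//.
rewrite lerD//; first by rewrite normc_def /= expr0n addr0 sqrtr_sqr.
rewrite normrM [X in X * _](_ : _ = 1).
  by rewrite mul1r normc_def /= expr0n addr0 sqrtr_sqr.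
by rewrite normc_def/= expr0n add0r expr1n sqrtr1.
Qed.

Lemma normr_Re_le (z : R[i]) : (`|complex.Re z|)%:C%C <= `|z|.
Proof. exact: normc_ge_Re. Qed.

Lemma normr_Im_le (z : R[i]) : (`|complex.Im z|)%:C%C <= `|z|.
Proof.
have := normc_ge_Re (z * 'i%C); rewrite ReiNIm normrN normrM.
rewrite [X in _ <= _ * X](_ : _ = 1) ?mulr1//.
by rewrite normc_def/= expr0n add0r expr1n sqrtr1.
Qed.

Lemma complex_complete (F : set_system (R[i] : numFieldType)) :
  ProperFilter F -> cauchy F -> cvg F.
Proof.
move=> PF /cauchyP Fc.
have part_cvg (p : R[i] -> R) : (forall z w, p (z - w) = p z - p w) ->
    (forall z, (`|p z|)%:C%C <= `|z|) -> cvg (p @ F).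
  move=> pB ple; apply: R_complete; apply: cauchy_exP => e e0.
  have eC0 : 0 < e%:C%C :> R[i] by rewrite ltcR.
  have [z Fz] := Fc _ eC0.
  exists (p z); change (F (p @^-1` ball (p z) e)).
  apply: filterS Fz => w; rewrite /preimage/= -!ball_normE/= => zw.
  by rewrite -pB -ltcR (le_lt_trans (ple _)).
have Re_cvg : cvg (@complex.Re R @ F).
  apply: part_cvg; last exact: normr_Re_le.
  exact: (raddfB (@complex.Re R : Rcomplex R -> R)).
have Im_cvg : cvg (@complex.Im R @ F).
  apply: part_cvg; last exact: normr_Im_le.
  exact: (raddfB (@complex.Im R : Rcomplex R -> R)).
apply/cvg_ex; exists (Complex (lim (@complex.Re R @ F)) (lim (@complex.Im R @ F))).
apply/cvgrPdist_lt => e e0.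
have eR : e = (complex.Re e)%:C%C.
  by rewrite RRe_real// gtr0_real.
have e20 : 0 < complex.Re e / 2.
  by rewrite divr_gt0// -ltcR -eR.
move/cvgrPdist_lt : Re_cvg => /(_ _ e20) nR.
move/cvgrPdist_lt : Im_cvg => /(_ _ e20) nI.
apply: filterS2 nR nI => z zR zI.
apply: (le_lt_trans (ler_norm_Re_Im _)); rewrite eR ltcR.
by rewrite [ltRHS]splitr ltrD//; case: (z) zR zI.
Qed.

Definition complex_scalar : scalarField :=
  @ScalarField R[i] (Num.conj : {rmorphism R[i] -> R[i]}) (@conjCK _)
    complex_mul_conj csqrt csqrt_ge0 sqr_csqrt complex_complete.

End ScalarFields.

(** * Exponentials of positive semidefinite real kernels *)

Section RealKernels.
Variable R : realType.
Local Notation rid := (@idfun R : {rmorphism R -> R}).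
Local Notation psd := (psd_kernel rid).
Local Notation rform := (kform rid).

(** The weights move into the coefficients. Distinct points may have equal images under [h], which
    lists with repetition allow. *)
Lemma psd_pullback (S T : Type) (h : S -> T) (a : S -> R) (k : T -> T -> R) s :
  rform (fun x y => a x * a y * k (h x) (h y)) s s =
  rform k [seq (p.1 * a p.2, h p.2) | p <- s] [seq (p.1 * a p.2, h p.2) | p <- s].
Proof.
rewrite !kformE big_map; apply: eq_bigr => q _; rewrite big_map.
by apply: eq_bigr => p _ /=; ring.
Qed.

Lemma psd_pull (S T : Type) (h : S -> T) (a : S -> R) (k : T -> T -> R) :
  psd k -> psd (fun x y => a x * a y * k (h x) (h y)).
Proof. by move=> kpsd s; rewrite psd_pullback. Qed.

Lemma psd_lin (T : Type) (a : R) (k1 k2 : T -> T -> R) : 0 <= a ->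
  psd k1 -> psd k2 -> psd (fun x y => a * k1 x y + k2 x y).
Proof.
move=> a0 k1psd k2psd s.
suff -> : rform (fun x y => a * k1 x y + k2 x y) s s =
    a * rform k1 s s + rform k2 s s by rewrite addr_ge0// mulr_ge0.
rewrite !kformE mulr_sumr -big_split; apply: eq_bigr => q _ /=.
rewrite mulr_sumr -big_split; apply: eq_bigr => p _ /=; ring.
Qed.

Lemma psd_cvg (T : Type) (k_ : nat -> T -> T -> R) (k : T -> T -> R) :
  (forall n, psd (k_ n)) -> (forall x y, k_ n x y @[n --> \oo] --> k x y) ->
  psd k.
Proof.
move=> kpsd kcvg s.
have form_cvg : rform (k_ n) s s @[n --> \oo] --> rform k s s.
  rewrite kformE; under eq_fun do rewrite kformE.
  apply: cvg_big => [|q _]; first exact: add_continuous.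
  apply: cvg_big => [|p _]; first exact: add_continuous.
  by apply: cvgMr; exact: kcvg.
apply: (cvgr_to_ge form_cvg).
by near=> n; exact: kpsd.
Unshelve. all: by end_near. Qed.

Lemma psd_cst1 (T : Type) : psd (fun _ _ : T => 1).
Proof.
move=> s; rewrite (_ : rform _ s s = (\sum_(p <- s) p.1) ^+ 2) ?sqr_ge0//.
rewrite kformE expr2 mulr_sumr; apply: eq_bigr => q _.
by rewrite mulr_suml; apply: eq_bigr => p _; rewrite mulr1.
Qed.

(** The Schur product theorem by symmetric elimination. Each step subtracts from [k1] a rank one
    kernel and thereby removes a point of [zs] from its support; the product of a rank one kernel
    with [k2] is a weighted form of [k2]. With no point left, [k1] vanishes on [s]. *)
Lemma psd_mul_on (T : eqType) (zs : seq T) (k1 k2 : T -> T -> R) s :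
  (forall x y, k1 y x = k1 x y) -> psd k1 -> psd k2 ->
  (forall p, p \in s -> p.2 \notin zs -> forall y, k1 y p.2 = 0) ->
  0 <= rform (fun x y => k1 x y * k2 x y) s s.
Proof.
elim: zs k1 => [|z zs IH] k1 k1C k1psd k2psd k1s.
  rewrite kformE big1_seq// => q _; rewrite big1_seq// => p /= ps.
  by rewrite k1s// mul0r mulr0.
have CS x y : k1 x y ^+ 2 <= k1 x x * k1 y y.
  have := kform_cauchy_schwarz (theta := rid) (fun=> erefl) (@real_mul_idfun R)
    [:: (1, y)] [:: (1, x)] k1C k1psd.
  rewrite !kformE !big_seq1 /= !mulr1 !mul1r real_normK ?num_real//.
  by rewrite mulrC.
(* Pivoting at [z]: [k1] is the sum of [k3], which vanishes at [z], and of a rank one kernel;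
   division by [k1 z z = 0] is harmless since then [k1 _ z] vanishes. *)
pose k3 x y := k1 x y - k1 x z * k1 y z / k1 z z.
have k3z y : k3 y z = 0.
  rewrite /k3; have [z0|z0] := eqVneq (k1 z z) 0; last by rewrite mulfK ?subrr.
  have := CS y z; rewrite z0 mulr0 exprn_even_le0//= => /eqP ->.
  by rewrite !mul0r subr0.
have zz0 : 0 <= k1 z z.
  by have := k1psd [:: (1, z)]; rewrite kformE !big_seq1 /= !mul1r.
(* Positivity of this Schur complement is Cauchy-Schwarz between [t] and the point [z]. *)
have k3psd : psd k3.
  move=> t; have := kform_cauchy_schwarz (theta := rid) (fun=> erefl)
    (@real_mul_idfun R) t [:: (1, z)] k1C k1psd.
  rewrite [X in `|X|]/kform pairing_seq1 [kform _ _ [:: _] [:: _]]kformE.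
  rewrite !big_seq1 /= !mul1r real_normK ?num_real// => CSt.
  rewrite (_ : rform k3 t t =
    rform k1 t t - comb k1 t z ^+ 2 / k1 z z); last first.
    rewrite !kformE expr2 mulr_sumr mulr_suml -sumrB; apply: eq_bigr => q _.
    rewrite !mulr_suml -sumrB; apply: eq_bigr => p _ /=.
    by rewrite /k3 (k1C q.2 z) (k1C p.2 z); ring.
  move: zz0; rewrite le_eqVlt => /predU1P[z0|zz0].
    by rewrite -z0 invr0 mulr0 subr0.
  by rewrite subr_ge0 ler_pdivrMr.
rewrite (_ : rform _ s s = rform (fun x y => k3 x y * k2 x y) s s +
  (k1 z z)^-1 * rform (fun x y => k1 x z * k1 y z * k2 x y) s s); last first.
  rewrite !kformE mulr_sumr -big_split; apply: eq_bigr => q _ /=.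
  rewrite mulr_sumr -big_split; apply: eq_bigr => p _ /=.
  by rewrite /k3; ring.
rewrite addr_ge0//; last first.
  by rewrite mulr_ge0 ?invr_ge0//; exact: (psd_pull id).
apply: IH => //; first by move=> x y; rewrite /k3 k1C (mulrC (k1 y z)).
move=> p ps pzs y; have [->|pz] := eqVneq p.2 z; first exact: k3z.
have pk w : k1 w p.2 = 0 by apply: k1s; rewrite // inE negb_or pz.
by rewrite /k3 pk (k1C z p.2) pk mulr0 mul0r subr0.
Qed.

Lemma psd_mul (T : Type) (k1 k2 : T -> T -> R) :
  (forall x y, k1 y x = k1 x y) -> psd k1 -> psd k2 ->
  psd (fun x y => k1 x y * k2 x y).
Proof.
move=> k1C k1psd k2psd s.
apply: (@psd_mul_on {classic T} [seq p.2 | p <- (s : seq (R * {classic T}))]) => //.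
by move=> p ps; rewrite map_f.
Qed.

(** Powers are Schur products, the partial sums of the exponential series are nonnegative
    combinations of them, and positivity passes to the limit. *)
Lemma psd_exp (T : Type) (k : T -> T -> R) :
  (forall x y, k y x = k x y) -> psd k -> psd (fun x y => expR (k x y)).
Proof.
move=> kC kpsd.
have pow n : psd (fun x y => k x y ^+ n).
  elim: n => [|n IH]; first exact: psd_cst1.
  have := psd_mul kC kpsd IH; congr psd_kernel.
  by apply: funext => x; apply: funext => y; rewrite exprS.
apply: (@psd_cvg _ (fun n x y => series (exp_coeff (k x y)) n)).
  elim=> [|n IH].
    move=> s; rewrite kformE big1 // => q _; rewrite big1// => p _.
    by rewrite /series/= big_geq// mulr0.
  have n0 : 0 <= (n`!%:R)^-1 :> R by rewrite invr_ge0.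
  have := psd_lin n0 (pow n) IH; congr psd_kernel.
  apply: funext => x; apply: funext => y.
  by rewrite seriesSr addrC mulrC.
by move=> x y; exact: is_cvg_series_exp_coeff.
Qed.

End RealKernels.

(** * The Stone-Weierstrass theorem on a compact subset *)

(* Topological induction: a nonempty ideal of sets that contains a neighbourhood trace at
   every point of a compact set contains that set. *)
Lemma compact_ind (T : topologicalType) (C : set T) (P : set T -> Prop) :
  compact C -> P set0 -> (forall A B, A `<=` B -> P B -> P A) ->
  (forall A B, P A -> P B -> P (A `|` B)) ->
  (forall y, C y -> exists2 V, nbhs y V & P (C `&` V)) -> P C.
Proof.
move=> Ccpt P0 Pmono PU Ploc; apply: contrapT => nPC.
pose F : set_system T := fun B => P (C `\` B).
have FF : Filter F.
  split; rewrite /F.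
  - by rewrite setDT.
  - by move=> A B PA PB; rewrite setDIr; exact: PU.
  - by move=> A B AB; apply: Pmono; exact: setDS.
have PF : ProperFilter F by split=> //; rewrite /F setD0.
have [|y [Cy yF]] := Ccpt F PF; first by rewrite /F setDv.
have [V yV PV] := Ploc y Cy.
have FV : F (~` V) by rewrite /F setDE setCK.
by have [z []] := yF _ _ FV yV.
Qed.

(* Newton-like iteration for the square root of [t ^+ 2]. *)
Fixpoint abs_approx (R : realFieldType) (n : nat) (t : R) : R :=
  if n is m.+1 then abs_approx m t + (t ^+ 2 - abs_approx m t ^+ 2) / 2 else 0.

(** The error [r] becomes [r * (1 - |t| + r / 2)], at most [r * (1 - r / 2)] because [r <= |t|].
    This recursion forces a decay of order [2 / n], uniform in [t]. *)
Lemma abs_approxP (R : realFieldType) n (t : R) : `|t| <= 1 ->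
  [/\ 0 <= abs_approx n t, abs_approx n t <= `|t|
    & (`|t| - abs_approx n t) * n.+1%:R <= 2].
Proof.
move=> t1; have t0 := normr_ge0 t.
elim: n => [|n [p0 pt pn]] /=; first by split=> //; lra.
have tt : t ^+ 2 = `|t| ^+ 2 by rewrite real_normK ?num_real.
rewrite tt; move: t1 t0 p0 pt pn; set a := `|t|; set p := abs_approx n t.
rewrite -[n.+2]addn1 natrD; set m := n.+1%:R.
have m1 : 1 <= m :> R by rewrite ler1n.
move=> t1 t0 p0 pt pn.
have h1 : 0 <= (a - p) * (a + p) by rewrite mulr_ge0//; lra.
have h2 : 0 <= (a - p) * (2 - (a + p)) by rewrite mulr_ge0//; lra.
split; [lra|lra|]; set r := a - p in pn *.
have -> : a - (p + (a ^+ 2 - p ^+ 2) / 2) = r * (1 - a + r / 2).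
  by rewrite /r; field.
have r0 : 0 <= r by rewrite subr_ge0.
have ra : r <= a by rewrite /r; lra.
apply: (@le_trans _ _ (r * (1 - r / 2) * (m + 1))).
  have m0 : 0 <= m + 1 by lra.
  by rewrite ler_wpM2r// ler_wpM2l//; lra.
nra.
Qed.

Section StoneWeierstrass.
Variables (R : realType) (T : topologicalType) (C : set T).
Hypothesis C_compact : compact C.
Implicit Types (f g d : T -> R).

Lemma within_continuous_near f : {within C, continuous f} ->
  forall y, C y -> forall e, 0 < e ->
    \forall z \near y, C z -> `|f y - f z| < e.
Proof.
move=> /subspace_continuousP fc y Cy e e0.
by move/cvgrPdist_lt : (fc y Cy) => /(_ _ e0).
Qed.

Lemma within_continuous_bounded f : {within C, continuous f} ->
  exists2 M, 0 < M & forall x, C x -> `|f x| <= M.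
Proof.
move=> fc; pose P A := exists2 M, 0 < M & forall x, A x -> `|f x| <= M.
apply: (compact_ind (P := P) C_compact).
- by exists 1.
- by move=> A B AB [M M0 BM]; exists M => // x /AB; exact: BM.
- move=> A B [M M0 AM] [N N0 BN]; exists (M + N); first exact: addr_gt0.
  move=> x [/AM|/BN] /le_trans; apply; first by rewrite lerDl ltW.
  by rewrite lerDr ltW.
- move=> y Cy; exists [set z | C z -> `|f y - f z| < 1].
    exact: within_continuous_near.
  exists (`|f y| + 1); first by rewrite ltr_wpDl.
  move=> z [Cz /(_ Cz) fz]; rewrite -(subrK (f y) (f z)) addrC.
  by rewrite (le_trans (ler_normD _ _))// lerD2l distrC ltW.
Qed.

Variable D : set (T -> R).
Hypothesis D_cst : D (fun=> 1).
Hypothesis D_lin : forall a f g, D f -> D g -> D (fun x => a * f x + g x).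
Hypothesis D_mul : forall f g, D f -> D g -> D (fun x => f x * g x).
Hypothesis D_cont : forall f, D f -> {within C, continuous f}.
Hypothesis D_sep : forall x y, C x -> C y -> x <> y ->
  exists2 f, D f & f x <> f y.

(** The uniform closure of [D] on [C], which is a lattice although [D] need not be one. *)
Let U : set (T -> R) := fun f =>
  forall e, 0 < e -> exists2 d, D d & forall x, C x -> `|f x - d x| <= e.

Let U_of_D f : D f -> U f.
Proof. by move=> Df e e0; exists f => // x _; rewrite subrr normr0 ltW. Qed.

Let U_closed f : (forall e, 0 < e ->
  exists2 g, U g & forall x, C x -> `|f x - g x| <= e) -> U f.
Proof.
move=> fU e e0; have e20 : 0 < e / 2 by rewrite divr_gt0.
have [g Ug fg] := fU _ e20; have [d Dd gd] := Ug _ e20.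
exists d => // x Cx; rewrite (le_trans (ler_distD (g x) _ _))// (splitr e).
by rewrite lerD ?fg ?gd.
Qed.

Let U_lin a f g : U f -> U g -> U (fun x => a * f x + g x).
Proof.
move=> Uf Ug e e0; have d0 : 0 < e / (`|a| + 1).
  by rewrite divr_gt0// ltr_wpDl.
have [d Dd fd] := Uf _ d0; have [d' Dd' gd'] := Ug _ d0.
exists (fun x => a * d x + d' x); first exact: D_lin.
move=> x Cx; rewrite opprD addrACA -mulrBr.
rewrite (le_trans (ler_normD _ _))// normrM.
rewrite [leRHS](_ : _ = `|a| * (e / (`|a| + 1)) + e / (`|a| + 1)).
  by rewrite lerD ?gd'// ler_wpM2l// fd.
by field; rewrite gt_eqF// ltr_wpDl.
Qed.

Let eqU f g : f =1 g -> U f -> U g.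
Proof. by move=> /funext ->. Qed.

Let U_bounded f : U f -> exists2 M, 0 < M & forall x, C x -> `|f x| <= M.
Proof.
move=> Uf; have [d Dd fd] := Uf _ ltr01; have [M M0 dM] := within_continuous_bounded (D_cont Dd).
exists (1 + M); first exact: addr_gt0.
move=> x Cx; rewrite -(subrK (d x) (f x)) (le_trans (ler_normD _ _))//.
by rewrite lerD ?fd ?dM.
Qed.

Let U_sqr f : U f -> U (fun x => f x ^+ 2).
Proof.
move=> Uf e e0; have [M M0 fM] := U_bounded Uf.
(* In the factorization of [f ^+ 2 - d ^+ 2] below, the second factor is at most [2 * M + 1] once
   [d] is within 1 of [f]. *)
have m0 : 0 < Num.min 1 (e / (2 * M + 1)).
  by rewrite lt_min ltr01 divr_gt0// addr_gt0// mulr_gt0.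
have [d Dd fd] := Uf _ m0; exists (fun x => d x * d x); first exact: D_mul.
move=> x Cx; have := fd x Cx; rewrite le_min => /andP[fd1 fde].
have -> : f x ^+ 2 - d x * d x = (f x - d x) * (2 * f x - (f x - d x)) by ring.
rewrite normrM -[leRHS](@divfK _ (2 * M + 1)); last first.
  by rewrite gt_eqF// addr_gt0// mulr_gt0.
apply: ler_pM => //; rewrite (le_trans (ler_normB _ _))// lerD//.
by rewrite normrM ger0_norm// ler_pM2l// fM.
Qed.

Let U_abs f : U f -> U (fun x => `|f x|).
Proof.
move=> Uf; have [M M0 fM] := U_bounded Uf.
have U0 : U (fun=> 0).
  by apply: (eqU _ (U_lin (-1) (U_of_D D_cst) (U_of_D D_cst))) => x; ring.
have Mi0 : 0 <= M^-1 by rewrite invr_ge0 ltW.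
pose h x := M^-1 * f x.
have Uh : U h by apply: (eqU _ (U_lin M^-1 Uf U0)) => x; rewrite addr0.
have h1 x : C x -> `|h x| <= 1.
  move=> Cx; rewrite /h normrM (ger0_norm Mi0).
  by rewrite ler_pdivrMl// mulr1 fM.
have Uabs n : U (fun x => abs_approx n (h x)).
  elim: n => [|n IH] //=.
  apply: (eqU _ (U_lin (2^-1) (U_lin (-1) (U_sqr IH) (U_sqr Uh)) IH)) => x /=.
  by ring.
suff Uah : U (fun x => `|h x|).
  apply: (eqU _ (U_lin M Uah U0)) => x; rewrite addr0 /h normrM.
  by rewrite (ger0_norm Mi0) mulrA divff ?gt_eqF// mul1r.
apply: U_closed => e e0.
have [n en] : exists n : nat, 2 / e < n.+1%:R.
  exists (Num.truncn (2 / e)); have := truncnS_gt (2 / e).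
  by [].
exists (fun x => abs_approx n (h x)) => // x /h1 /abs_approxP-/(_ n)[p0 pt pn].
rewrite ger0_norm ?subr_ge0//.
rewrite -(@ler_pM2r _ n.+1%:R) ?ltr0n//; apply: (le_trans pn).
by rewrite mulrC -ler_pdivrMr// ltW.
Qed.

Let U_max f g : U f -> U g -> U (fun x => Num.max (f x) (g x)).
Proof.
move=> Uf Ug.
(* The maximum is half of [f + g + |f - g|]. The last argument is the zero function, since [U_lin]
   always expects a second summand. *)
apply: (eqU _ (U_lin 2^-1 (U_lin 1 Uf (U_lin 1 Ug (U_abs (U_lin (-1) Ug Uf))))
  (U_lin 0 Uf (U_lin (-1) Uf Uf)))) => x.
by rewrite maxr_absE (_ : -1 * g x + f x = f x - g x); [field|ring].
Qed.

Let U_min f g : U f -> U g -> U (fun x => Num.min (f x) (g x)).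
Proof.
move=> Uf Ug.
apply: (eqU _ (U_lin (-1) (U_max Uf Ug) (U_lin 1 Uf Ug))) => x.
by have := addr_max_min (f x) (g x); lra.
Qed.

(** Two compactness arguments: for fixed [x], minima of functions interpolating [f] at [x] and [y]
    stay below [f + e] on [C] and above [f - e] near [x]; maxima of these over [x] are then above
    [f - e] on all of [C]. *)
Lemma stone_weierstrass f e : {within C, continuous f} -> 0 < e ->
  exists2 d, D d & forall x, C x -> `|f x - d x| < e.
Proof.
move=> /within_continuous_near fc e0.
have D_near d Dd := within_continuous_near (@D_cont d Dd).
suff [u Uu fu] : exists2 u, U u & forall x, C x -> `|f x - u x| < e / 2.
  have [d Dd ud] := Uu _ (divr_gt0 e0 (ltr0Sn R 1)).
  exists d => // x Cx; rewrite (le_lt_trans (ler_distD (u x) _ _))//.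
  by rewrite (splitr e) ltr_leD ?fu ?ud.
have {}e0 : 0 < e / 2 by rewrite divr_gt0.
move: (e / 2) e0 => {}e e0; have e20 : 0 < e / 2 by rewrite divr_gt0.
have U_cst c : U (fun=> c).
  apply: (eqU _ (U_lin (c - 1) (U_of_D D_cst) (U_of_D D_cst))) => x; ring.
have below x : C x -> exists u, [/\ U u,
    \forall z \near x, C z -> f z - e < u z & forall z, C z -> u z < f z + e].
  move=> Cx; pose P A := exists u, [/\ U u,
    \forall z \near x, C z -> f z - e < u z & forall z, A z -> u z < f z + e].
  have near_lt d y : D d -> C y -> d y = f y ->
      \forall z \near y, C z -> `|f z - d z| < e.
    move=> Dd Cy dy; apply: filterS2 (D_near _ Dd _ Cy _ e20) (fc y Cy _ e20) => z.
    move=> dz fz Cz; rewrite (splitr e) (le_lt_trans (ler_distD (f y) _ _))//.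
    by apply: ltrD; [rewrite distrC fz|rewrite -dy dz].
  apply: (compact_ind (P := P) C_compact).
  - exists (fun=> f x); split => //.
    apply: filterS (fc x Cx e e0) => z /[apply]; rewrite ltr_norml.
    by move=> /andP[? ?]; lra.
  - by move=> A B AB [u [Uu nu uB]]; exists u; split=> // z /AB /uB.
  - move=> A B [u [Uu nu uA]] [v [Uv nv vB]].
    exists (fun z => Num.min (u z) (v z)); split; first exact: U_min.
      apply: filterS2 nu nv => z uz vz Cz.
      by rewrite lt_min uz ?vz.
    by move=> z [/uA|/vB] h; rewrite gt_min h ?orbT.
  - move=> y Cy.
    (* An affine function of a separating function, or a constant if [x = y]. A constant [b] is
       written [(b - 1) * 1 + 1] to fit [D_cst] and [D_lin]. *)
    have [d [Dd dx dy]] : exists d, [/\ D d, d x = f x & d y = f y].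
      have [->|xy] := pselect (x = y).
        exists (fun z => (f y - 1) * 1 + 1); split; [exact: D_lin|ring|ring].
      have [d Dd dxy] := D_sep Cx Cy xy.
      have {}dxy : d x - d y != 0 by rewrite subr_eq0; exact/eqP.
      pose a := (f x - f y) / (d x - d y).
      exists (fun z => a * d z + ((f x - a * d x - 1) * 1 + 1)).
      by split; [do 2?apply: D_lin|rewrite /a; ring|rewrite /a; field].
    exists [set z | C z -> `|f z - d z| < e]; first exact: near_lt.
    exists d; split; first exact: U_of_D.
      apply: filterS (near_lt d x Dd Cx dx) => z /[apply].
      by rewrite ltr_norml => /andP[? ?]; lra.
    by move=> z [Cz /(_ Cz)]; rewrite ltr_norml => /andP[? ?]; lra.
pose Q A := exists2 u, U u /\ (forall z, C z -> u z < f z + e) &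
  forall z, A z -> f z - e < u z.
have [u [Uu ub] ua] : Q C.
  (* The induction starts from a function below [f + e], which [below] supplies only at a point of
     [C]. *)
  have [[x Cx]|C0] := pselect (exists x, C x); last first.
    by exists (fun=> 0); [split=> // z Cz; case: C0; exists z|
      move=> z Cz; case: C0; exists z].
  apply: (compact_ind (P := Q) C_compact).
  - by have [u [Uu _ ub]] := below x Cx; exists u.
  - by move=> A B AB [u Uu uB]; exists u => // z /AB /uB.
  - move=> A B [u [Uu ub] uA] [v [Uv vb] vB].
    exists (fun z => Num.max (u z) (v z)).
      by split; [exact: U_max|move=> z Cz; rewrite gt_max ub ?vb].
    by move=> z [/uA|/vB] h; rewrite lt_max h ?orbT.
  - move=> y Cy; have [u [Uu nu ub]] := below y Cy.
    exists [set z | C z -> f z - e < u z] => //.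
    by exists u => // z [Cz]; apply.
exists u => // x Cx; have := ub x Cx; have := ua x Cx.
by rewrite ltr_norml => ? ?; apply/andP; split; lra.
Qed.

End StoneWeierstrass.

(** * Density of kernel combinations on compact sets *)

Section RealHilbert.
Variables (R : realType) (H : hilbertSpace (@idfun R)).
Local Notation rid := (@idfun R : {rmorphism R -> R}).
Local Notation dot := (hdot H).
Implicit Types u v w : H.

Lemma hdotC u v : dot v u = dot u v.
Proof.
by have := @hermC R false rid H dot v u; rewrite expr0 mul1r.
Qed.

Lemma hdotZl a u v : dot (a *: u) v = a * dot u v.
Proof. exact: (linearZl_LR dot). Qed.

Lemma hdotZr a u v : dot u (a *: v) = a * dot u v.
Proof. by rewrite hdotC hdotZl hdotC. Qed.

Lemma hdotBl u v w : dot (u - v) w = dot u w - dot v w.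
Proof. exact: (linearBl dot). Qed.

Lemma hdot_ge0 u : 0 <= dot u u.
Proof. by rewrite -hnormE sqr_ge0. Qed.

Lemma sqr_hnormB u v :
  `|u - v| ^+ 2 = `|u| ^+ 2 + `|v| ^+ 2 - 2 * dot u v.
Proof.
rewrite !hnormE linearBl !linearBr/= (hdotC u v); ring.
Qed.

Lemma psd_hdot : psd_kernel rid (fun u v : H => 2 * dot u v).
Proof.
move=> s; pose U := \sum_(p <- s) p.1 *: p.2 : H.
suff -> : kform rid (fun u v : H => 2 * dot u v) s s = 2 * dot U U.
  by rewrite mulr_ge0// hdot_ge0.
rewrite kformE /U linear_sumlz mulr_sumr; apply: eq_bigr => q _.
rewrite linear_sumr mulr_sumr; apply: eq_bigr => p _ /=.
by rewrite hdotZl hdotZr; ring.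
Qed.

Lemma hdot_cauchy_schwarz u v : `|dot u v| <= `|u| * `|v|.
Proof.
rewrite -(@ler_pXn2r _ 2) ?nnegrE ?mulr_ge0// exprMn !hnormE.
apply: (cauchy_schwarz_coef (theta := rid) (@real_mul_idfun R)) => [|l].
  exact: hdot_ge0.
have := hdot_ge0 (u + l *: v).
rewrite linearDl !linearDr/= !hdotZl !hdotZr (hdotC u v).
by congr (0 <= _); rewrite /=; ring.
Qed.

End RealHilbert.

Section Density.
Variable R : realType.
Local Notation rid := (@idfun R : {rmorphism R -> R}).
Local Notation psd := (psd_kernel rid).
Local Notation rform := (kform rid).
Local Notation rpair := (pairing rid).

(* An almost minimizer of the quadratic functional [Q v - 2 f v] almost represents [f]. *)
Lemma riesz_approx (T : Type) (k : T -> T -> R) (f : T -> R) (M e : R) :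
  (forall x y, k y x = k x y) -> psd k -> 0 <= M ->
  (forall s, rpair f s ^+ 2 <= M * rform k s s) -> 0 < e ->
  exists v, forall x, (f x - comb k v x) ^+ 2 <= e ^+ 2 * k x x.
Proof.
move=> kC kpsd M0 fM e0.
pose J v := rform k v v - 2 * rpair f v.
(* From [p ^+ 2 <= M * q], the arithmetic-geometric inequality gives [2 * p <= M + q]. *)
have J_ge v : - M <= J v.
  have := fM v; have := kpsd v; rewrite /J.
  set q := rform k v v; set p := rpair f v => q0 pM.
  rewrite leNgt; apply/negP => pq.
  have : (M + q) ^+ 2 < (2 * p) ^+ 2.
    by rewrite ltr_pXn2r// ?nnegrE; lra.
  have := sqr_ge0 (M - q); nra.
have J_inf : has_inf (range J).
  split; first by exists (J [::]), [::].
  by exists (- M) => _ [v _ <-].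
have [_ [v _ <-] Jv] := inf_adherent (exprn_gt0 2 e0) J_inf.
exists v => x; have kxx : 0 <= k x x.
  by have := kpsd [:: (1, x)]; rewrite kformE !big_seq1 /= !mul1r.
rewrite -[leLHS]real_normK ?num_real//.
apply: (cauchy_schwarz_coef (theta := rid) (@real_mul_idfun R)) => // l.
(* Moving [v] by [- l] at [x] lowers [J] by less than [e ^+ 2]. Expanded in [l], this is the
   hypothesis of [cauchy_schwarz_coef] with [a = e ^+ 2], [b = k x x] and [c = f x - comb k v x]. *)
have Jl : inf (range J) <= J (v ++ [:: (- l, x)]).
  by apply: ge_inf; [exists (- M) => _ [w _ <-]|exists (v ++ [:: (- l, x)])].
have := lt_le_trans Jv (lerD Jl (lexx (e ^+ 2))).
rewrite {1 2}/J kform_catl !kform_catr pairing_cat.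
rewrite (kform_sym (theta := rid) (fun=> erefl) v [:: (- l, x)] kC).
rewrite /rpair /kform /pairing !big_seq1 /= comb_seq1 -/(pairing _ _ _).
rewrite -!/(pairing rid _ _) => h; lra.
Qed.

Variables (X : Type) (H : hilbertSpace (@idfun R)) (h : X -> H) (a : X -> R).

Definition hilbert_exp_kernel (x y : X) : R :=
  a x * a y * expR (2 * hdot H (h x) (h y)).
Local Notation G := hilbert_exp_kernel.

Lemma hilbert_exp_kernel_sym x y : G y x = G x y.
Proof. by rewrite /G (mulrC (a y)) hdotC. Qed.

Let psd_E : psd (fun u v : H => expR (2 * hdot H u v)).
Proof. by apply: psd_exp; [move=> u v; rewrite hdotC|exact: psd_hdot]. Qed.

Lemma psd_hilbert_exp_kernel : psd G.
Proof. exact: (psd_pull h a psd_E). Qed.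

(* Cauchy-Schwarz against the point [w / 2] of [H], which need not lie in the range of [h]. *)
Lemma exp_hdot_approx (w : H) e : 0 < e ->
  exists v, forall x,
    (a x * expR (hdot H (h x) w) - comb G v x) ^+ 2 <= e ^+ 2 * G x x.
Proof.
pose u := 2^-1 *: w : H; pose E := fun u v : H => expR (2 * hdot H u v).
move=> e0; apply: (@riesz_approx _ G _ (E u u)) => //.
- exact: hilbert_exp_kernel_sym.
- exact: psd_hilbert_exp_kernel.
- exact: expR_ge0.
move=> s; rewrite (psd_pullback h a E s : rform G s s = _) mulrC; set t := [seq _ | _ <- _].
have := kform_cauchy_schwarz (theta := rid) (fun=> erefl) (@real_mul_idfun R)
  t [:: (1, u)] _ psd_E.
rewrite [rform _ [:: _] [:: _]]kformE !big_seq1 /= !mul1r real_normK ?num_real//.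
rewrite [X in X ^+ 2 <= _](_ : _ = rpair (fun x => a x * expR (hdot H (h x) w)) s).
  by apply => ? ?; rewrite hdotC.
rewrite kformE big_seq1 big_map; apply: eq_bigr => p _ /=.
by rewrite mulr1 hdotC hdotZr mulrA divff// mul1r mulrA.
Qed.

End Density.

Section CompactDensity.
Variables (R : realType) (X : topologicalType) (H : hilbertSpace (@idfun R)).
Variables (h : X -> H) (a : X -> R).
Hypotheses (h_cont : continuous h) (a_cont : continuous a).
Hypotheses (h_inj : injective h) (a_gt0 : forall x, 0 < a x).
Local Notation G := (hilbert_exp_kernel h a).

Let exp_sum (l : seq (R * H)) (x : X) : R :=
  \sum_(p <- l) p.1 * expR (hdot H (h x) p.2).

Lemma hdot_comp_continuous (w : H) : continuous (fun x => hdot H (h x) w).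
Proof.
move=> y; apply/cvgrPdist_lt => e e0.
have d0 : 0 < e / (`|w| + 1) by rewrite divr_gt0// ltr_wpDl.
have : \forall x \near y, `|h y - h x| < e / (`|w| + 1).
  by move/cvgrPdist_lt : (@h_cont y); exact.
apply: filterS => x hxy; rewrite -hdotBl.
apply: (le_lt_trans (hdot_cauchy_schwarz _ _)).
apply: (@le_lt_trans _ _ (e / (`|w| + 1) * `|w|)).
  by rewrite ler_wpM2r// ltW.
by rewrite mulrAC ltr_pdivrMr ?ltr_wpDl// ltr_pM2l// ltrDl.
Qed.

Lemma exp_hdot_continuous (w : H) :
  continuous (fun x => expR (hdot H (h x) w)).
Proof.
move=> x; apply: (continuous_comp (@hdot_comp_continuous w x)).
exact: continuous_expR.
Qed.

Let exp_sum_continuous l : continuous (exp_sum l).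
Proof.
move=> x; rewrite /exp_sum; apply: cvg_big => [|p _].
  exact: add_continuous.
by apply: cvgMr; exact: exp_hdot_continuous.
Qed.

Let G_diag_continuous : continuous (fun x => G x x).
Proof.
move=> x; apply: cvgM; first by apply: cvgM; exact: a_cont.
have norm_cont : continuous (fun y => 2 * hdot H (h y) (h y)).
  rewrite (_ : (fun _ => _) = fun y => 2 * (`|h y| * `|h y|)); last first.
    by apply: funext => y; rewrite -hnormE expr2.
  move=> y; apply: cvgMr.
  by apply: cvgM; apply: cvg_norm; exact: h_cont.
by apply: (continuous_comp (@norm_cont x)); exact: continuous_expR.
Qed.

Let exp_sum_approx (C : set X) l e : compact C -> 0 < e ->
  exists v, forall x, C x -> `|a x * exp_sum l x - comb G v x| <= e.
Proof.
move=> Ccpt; have [M M0 GM] := within_continuous_bounded Ccpt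
  (continuous_subspaceT G_diag_continuous).
elim: l e => [|[c w] l IH] e e0.
  exists [::] => x _; rewrite /exp_sum big_nil comb_nil mulr0 subrr normr0.
  exact: ltW.
have [v vl] := IH _ (divr_gt0 e0 (ltr0Sn R 1)).
(* On [C] the error for one exponential is at most [d] times the root of [G x x], itself at most
   [M + 1]; after multiplication by [c] at most [e / 2] remains. *)
pose d := e / 2 / ((`|c| + 1) * (M + 1)).
have c0 : 0 < `|c| + 1 by rewrite ltr_wpDl.
have M10 : 0 < M + 1 by rewrite addr_gt0.
have d0 : 0 < d by rewrite !divr_gt0// mulr_gt0.
have [u uw] := exp_hdot_approx h a w d0.
exists (scale_comb c u ++ v) => x Cx.
rewrite comb_cat comb_scale /exp_sum big_cons /= -/(exp_sum l x).
have -> : a x * (c * expR (hdot H (h x) w) + exp_sum l x)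
    - (c * comb G u x + comb G v x) =
  c * (a x * expR (hdot H (h x) w) - comb G u x)
    + (a x * exp_sum l x - comb G v x) by ring.
rewrite (le_trans (ler_normD _ _))// (splitr e) lerD ?vl//.
have ux : `|a x * expR (hdot H (h x) w) - comb G u x| <= d * (M + 1).
  have dM0 : 0 <= d * (M + 1) by apply: mulr_ge0; exact: ltW.
  rewrite -(@ler_pXn2r _ 2) ?nnegrE//.
  rewrite real_normK ?num_real// (le_trans (uw x))//.
  rewrite [leRHS]exprMn.
  rewrite ler_wpM2l ?sqr_ge0//.
  have := GM x Cx; rewrite ler_norml => /andP[_].
  move=> GxM; nra.
rewrite normrM (@le_trans _ _ (`|c| * (d * (M + 1))))// ?ler_wpM2l//.
rewrite (_ : `|c| * _ = `|c| / (`|c| + 1) * (e / 2)); last first.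
  by rewrite /d; field; rewrite !gt_eqF.
by rewrite ger_pMl ?divr_gt0// ler_pdivrMr// mul1r lerDl.
Qed.

(** Stone-Weierstrass is applied to [g / a]. Multiplying back by [a], bounded by [M] on [C], costs
    half of the error; passing from exponential sums to kernel combinations costs the other half. *)
Lemma comb_dense (C : set X) (g : X -> R) e : compact C ->
  {within C, continuous g} -> 0 < e ->
  exists v, forall x, C x -> `|g x - comb G v x| < e.
Proof.
move=> Ccpt gc e0.
have [M M0 aM] := within_continuous_bounded Ccpt (continuous_subspaceT a_cont).
pose D : set (X -> R) := [set f | exists l, f = exp_sum l].
have ga_cont : {within C, continuous (fun x => g x / a x)}.
  move=> x; apply: cvgM; first exact: gc.
  by apply: cvgV; [rewrite gt_eqF|exact: (continuous_subspaceT a_cont)].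
have d0 : 0 < e / 2 / M by rewrite !divr_gt0.
have [|||||_ [l ->] gd] := stone_weierstrass Ccpt _ _ _ _ _ ga_cont d0 (D := D).
- exists [:: (1, 0)]; apply: funext => x; rewrite /exp_sum big_seq1 /=.
  by rewrite linear0r expR0 mulr1.
- move=> c _ _ [l ->] [m ->]; exists (scale_comb c l ++ m).
  apply: funext => x; rewrite /exp_sum big_cat big_map mulr_sumr /=.
  by congr (_ + _); apply: eq_bigr => p _; rewrite mulrA.
- move=> _ _ [l ->] [m ->]; exists [seq (p.1 * q.1, p.2 + q.2) | p <- l, q <- m].
  apply: funext => x; rewrite /exp_sum big_allpairs_dep big_distrl /=.
  apply: eq_bigr => p _; rewrite mulr_sumr; apply: eq_bigr => q _ /=.
  by rewrite linearDr expRD mulrACA.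
- by move=> _ [l ->]; apply: continuous_subspaceT; exact: exp_sum_continuous.
(* The exponents at [x] and [y] differ by the squared norm of [w], nonzero since [h] is
   injective. *)
- move=> x y _ _ xy; pose w := h x - h y.
  exists (fun z => expR (hdot H (h z) w)).
    exists [:: (1, w)]; apply: funext => z.
    by rewrite /exp_sum big_seq1 mul1r.
  move=> /expR_inj/eqP; rewrite -subr_eq0 -hdotBl -hnormE sqrf_eq0 normr_eq0.
  by rewrite subr_eq0 => /eqP/h_inj.
have [v av] := exp_sum_approx l Ccpt (divr_gt0 e0 (ltr0Sn R 1)).
exists v => x Cx; rewrite (le_lt_trans (ler_distD (a x * exp_sum l x) _ _))//.
rewrite (splitr e) ltr_leD ?av//.
have -> : g x - a x * exp_sum l x = a x * (g x / a x - exp_sum l x).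
  by field; rewrite gt_eqF.
rewrite normrM; have := aM x Cx; have := gd x Cx.
set r := `|_ - _| => rd aM'.
apply: (@le_lt_trans _ _ (M * r)); first by rewrite ler_wpM2r// normr_ge0.
by move: rd; rewrite ltr_pdivlMr// mulrC.
Qed.

End CompactDensity.

(** * The complex reproducing kernel Hilbert space of a real kernel *)

Section ComplexKernels.
Variables (R : realType) (X : Type) (G : X -> X -> R).
Local Notation rid := (@idfun R : {rmorphism R -> R}).
Local Notation conj := (@Num.conj R[i] : {rmorphism R[i] -> R[i]}).
Hypothesis G_sym : forall x y, G y x = G x y.
Hypothesis G_psd : psd_kernel rid G.

(** The form splits into the real forms of the real and imaginary parts of the coefficients, plus
    ['i] times a cross term that vanishes because [G] is symmetric. *)
Lemma psd_complex_kernel : psd_kernel conj (complex_kernel G).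
Proof.
move=> s; pose re := [seq (complex.Re p.1, p.2) | p <- s].
pose im := [seq (complex.Im p.1, p.2) | p <- s].
suff -> : kform conj (complex_kernel G) s s =
    (kform rid G re re + kform rid G im im)%:C%C.
  by rewrite ler0c addr_ge0.
have im0 : \sum_(q <- s) \sum_(p <- s)
    (complex.Im p.1 * complex.Re q.1 - complex.Re p.1 * complex.Im q.1) * G q.2 p.2 = 0.
  under eq_bigr do under eq_bigr do rewrite mulrBl.
  under eq_bigr do rewrite sumrB; rewrite sumrB; apply/eqP; rewrite subr_eq0.
  rewrite [X in _ == X]exchange_big /=; apply/eqP; apply: eq_bigr => q _.
  by apply: eq_bigr => p _; rewrite (G_sym q.2) (mulrC (complex.Re q.1)).
pose u (q p : R[i] * X) := (complex.Re p.1 * complex.Re q.1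
  + complex.Im p.1 * complex.Im q.1) * G q.2 p.2.
have -> : kform rid G re re + kform rid G im im =
    \sum_(q <- s) \sum_(p <- s) u q p.
  rewrite !kformE !big_map -big_split; apply: eq_bigr => q _ /=.
  rewrite !big_map -big_split; apply: eq_bigr => p _ /=.
  by rewrite /u mulrDl.
set v := (X in X = 0) in im0.
suff -> : kform conj (complex_kernel G) s s =
    (\sum_(q <- s) \sum_(p <- s) u q p)%:C%C + 'i%C * v%:C%C.
  by rewrite im0 rmorph0 mulr0 addr0.
rewrite kformE /v !rmorph_sum mulr_sumr -big_split; apply: eq_bigr => q _.
rewrite !rmorph_sum mulr_sumr -big_split; apply: eq_bigr => p _ /=.
rewrite /complex_kernel /u; case: p.1 => a b; case: q.1 => c d.
apply/eqP; rewrite eq_complex /=; apply/andP; split; apply/eqP; ring.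
Qed.

Lemma complex_kernel_sym x y :
  complex_kernel G y x = conj (complex_kernel G x y).
Proof. by rewrite /complex_kernel G_sym; apply/esym/conjc_real. Qed.

Definition complex_psd_kernel : psdKernel :=
  @PsdKernel (complex_scalar R) X (complex_kernel G) complex_kernel_sym
    psd_complex_kernel.

Lemma pd_complex_kernel : pd_kernel (complex_kernel G).
Proof.
move=> n x c _; pose s := [seq (c i, x i) | i <- enum 'I_n].
suff -> : \sum_i \sum_j c i * (c j)^*%C * complex_kernel G (x i) (x j) =
    kform conj (complex_kernel G) s s by exact: psd_complex_kernel.
rewrite kformE big_map exchange_big -big_enum /=; apply: eq_bigr => j _.
rewrite big_map -big_enum; apply: eq_bigr => i _ /=.
by rewrite /complex_kernel G_sym.
Qed.

Definition complex_rkhs : hilbertSpace (@Num.conj R[i]) :=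
  rkhs_hilbert complex_psd_kernel.

Definition complex_rkhs_eval : {linear complex_rkhs -> (X -> R[i]^o)} :=
  rkhs_eval complex_psd_kernel.

Lemma complex_rkhsP : is_rkhs (complex_kernel G) complex_rkhs_eval.
Proof.
split; first exact: (@rkhs_inj complex_psd_kernel).
exists (@rkhs_point complex_psd_kernel); split.
- by move=> y; apply: funext => x; exact: (@rkhs_pointE complex_psd_kernel).
- by move=> F y; exact: (@rkhs_reproducing complex_psd_kernel).
- exact: (@rkhs_dense complex_psd_kernel).
Qed.

End ComplexKernels.

(** * Universality of the exponential kernel of a metrizable kernel *)

Section Universal.
Variables (R : realType) (X : topologicalType).
Local Notation rid := (@idfun R : {rmorphism R -> R}).

Lemma complex_rkhs_continuous (G : X -> X -> R)
    (G_sym : forall x y, G y x = G x y) (G_psd : psd_kernel rid G) :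
  continuous (fun p : X * X => G p.1 p.2) ->
  forall F : complex_rkhs G_sym G_psd, continuous (complex_rkhs_eval G_sym G_psd F).
Proof.
move=> G_cont F x.
apply/cvgrPdist_lt => e e0.
have eR : e = (complex.Re e)%:C%C by rewrite RRe_real// gtr0_real.
have nR : `|F| = (complex.Re `|F|)%:C%C by rewrite RRe_real// ger0_real.
have {}e0 : 0 < complex.Re e by rewrite -ltcR -eR.
set r := complex.Re e in eR e0; set M := complex.Re `|F| in nR.
pose phi y := M ^+ 2 * (G x x + G y y - G x y - G y x).
have phi_cont : phi y @[y --> x] --> phi x.
  have G1 : G x y @[y --> x] --> G x x.
    by apply: (@continuous_comp _ _ _ (fun y => (x, y)) _ x _ (@G_cont (x, x)));
       exact: cvg_pair (cvg_cst _) cvg_id.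
  have G2 : G y x @[y --> x] --> G x x.
    by apply: (@continuous_comp _ _ _ (fun y => (y, x)) _ x _ (@G_cont (x, x)));
       exact: cvg_pair cvg_id (cvg_cst _).
  have G3 : G y y @[y --> x] --> G x x.
    by apply: (@continuous_comp _ _ _ (fun y => (y, y)) _ x _ (@G_cont (x, x)));
       exact: cvg_pair cvg_id cvg_id.
  by apply: cvgMr; apply: cvgB => //; apply: cvgB => //; apply: cvgD => //;
    exact: cvg_cst.
have phix : phi x = 0 by rewrite /phi; ring.
have : \forall y \near x, phi y < r ^+ 2.
  apply: (cvgr_lt (phi x)) => //.
  by rewrite phix exprn_gt0.
apply: filterS => y phiy.
have := @rkhs_eval_dist (complex_psd_kernel G_sym G_psd) F x y.
rewrite [X in _ <= X](_ : _ = (phi y)%:C%C); last first.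
  by rewrite nR /phi /= /complex_kernel !rmorphM !rmorphB !rmorphD expr2.
move=> /le_lt_trans/(_ (_ : _ < e ^+ 2)) h.
rewrite -(@ltr_pXn2r _ 2) ?nnegrE ?normr_ge0//; last by rewrite eR ler0c ltW.
by apply: h; rewrite eR -rmorphXn ltcR.
Qed.

Variable gamma : X -> X -> R.
Hypothesis gamma_cont : continuous (fun p : X * X => gamma p.1 p.2).
Local Notation G := (exp_kernel gamma).

Section FromMetrizable.
Variables (H : hilbertSpace (@idfun R)) (h : X -> H).
Hypothesis gammaE :
  forall x y, gamma x y = `|h x - h y| ^+ 2 + gamma x x / 2 + gamma y y / 2.
Hypothesis h_inj : injective h.

Let a (x : X) : R := expR (- (gamma x x / 2 + `|h x| ^+ 2)).

Let exp_kernelE : G = hilbert_exp_kernel h a.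
Proof.
apply: funext => x; apply: funext => y.
rewrite /exp_kernel /hilbert_exp_kernel /a -!expRD gammaE sqr_hnormB.
by congr expR; ring.
Qed.

Let gamma_diag : continuous (fun x => gamma x x).
Proof.
move=> x; apply: (@continuous_comp _ _ _ (fun y => (y, y)) _ x _ (@gamma_cont (x, x))).
exact: cvg_pair cvg_id cvg_id.
Qed.

(** The squared distance from [h x] to [h y] is a continuous expression in [gamma] that vanishes at
    [y = x]. *)
Let h_cont : continuous h.
Proof.
move=> x; apply/cvgrPdist_lt => e e0.
have gx : gamma x y @[y --> x] --> gamma x x.
  apply: (@continuous_comp _ _ _ (fun y => (x, y)) _ x _ (@gamma_cont (x, x))).
  exact: cvg_pair (cvg_cst _) cvg_id.
have phi_cont : gamma x y - gamma x x / 2 - gamma y y / 2 @[y --> x] -->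
    gamma x x - gamma x x / 2 - gamma x x / 2.
  by apply: cvgB; [apply: cvgB => //; exact: cvg_cst|apply: cvgMl; exact: gamma_diag].
have : \forall y \near x, gamma x y - gamma x x / 2 - gamma y y / 2 < e ^+ 2.
  apply: (cvgr_lt _ phi_cont).
  by rewrite (_ : _ - _ - _ = 0) ?exprn_gt0//; field.
apply: filterS => y; rewrite gammaE => hxy.
rewrite -(@ltr_pXn2r _ 2) ?nnegrE ?normr_ge0 ?(ltW e0)//; lra.
Qed.

Let a_cont : continuous a.
Proof.
move=> x; apply: (@continuous_comp _ _ _ (fun x => - (gamma x x / 2 + `|h x| ^+ 2))).
  apply: cvgN; apply: cvgD; first by apply: cvgMl; exact: gamma_diag.
  rewrite expr2; under eq_fun do rewrite expr2.
  by apply: cvgM; apply: cvg_norm; exact: h_cont.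
exact: continuous_expR.
Qed.

Let G_cont : continuous (fun p : X * X => G p.1 p.2).
Proof.
move=> p; apply: (@continuous_comp _ _ _ (fun p : X * X => - gamma p.1 p.2)).
  by apply: cvgN; exact: gamma_cont.
exact: continuous_expR.
Qed.

Lemma universal_exp_kernel : universal_kernel (complex_kernel G).
Proof.
rewrite exp_kernelE; set k := hilbert_exp_kernel h a.
have k_sym := hilbert_exp_kernel_sym h a : forall x y, k y x = k x y.
have k_psd := psd_hilbert_exp_kernel h a : psd_kernel rid k.
split; first exact: pd_complex_kernel.
exists (complex_rkhs k_sym k_psd), (complex_rkhs_eval k_sym k_psd); split.
- exact: complex_rkhsP.
- by apply: complex_rkhs_continuous; rewrite /k -exp_kernelE.
move=> C g e Ccpt gc e0.
have part_cont (p : R[i]^o -> R) : (forall z w, `|p z - p w|%:C%C <= `|z - w|) ->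
    {within C, continuous (p \o g)}.
  move=> ple x; apply/cvgrPdist_lt => d d0.
  have dC : 0 < d%:C%C :> R[i] by rewrite ltcR.
  move/cvgrPdist_lt : (gc x) => /(_ _ dC); apply: filterS => y.
  by move=> /(le_lt_trans (ple _ _)); rewrite ltcR.
have Re_cont : {within C, continuous (@complex.Re R \o g)}.
  apply: part_cont => z w; rewrite -(raddfB (@complex.Re R : Rcomplex R -> R)).
  exact: normr_Re_le.
have Im_cont : {within C, continuous (@complex.Im R \o g)}.
  apply: part_cont => z w; rewrite -(raddfB (@complex.Im R : Rcomplex R -> R)).
  exact: normr_Im_le.
have a_gt0 x : 0 < a x by exact: expR_gt0.
(* Real and imaginary parts contribute [e / 4] each. The supremum is then at most [e / 2], which
   leaves room for the strict inequality. *)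
have e4 : 0 < e / 4 by rewrite divr_gt0.
have [u gu] := comb_dense h_cont a_cont h_inj a_gt0 Ccpt Re_cont e4.
have [v gv] := comb_dense h_cont a_cont h_inj a_gt0 Ccpt Im_cont e4.
pose s : seq (R[i] * X) := [seq (p.1%:C%C, p.2) | p <- u] ++
  [seq ('i%C * p.1%:C%C, p.2) | p <- v].
exists (rkhs_comb (D := complex_psd_kernel k_sym k_psd) s).
apply: (@le_lt_trans _ _ (e / 2)%:E); last first.
  by rewrite lte_fin ltr_pdivrMr// mulr_natr mulr2n ltrDl.
apply: ub_ereal_sup => _ [x Cx <-]; rewrite lee_fin.
rewrite -lecR RRe_real ?normr_real//.
set F := (X in X x - _).
have -> : F x - g x = (comb k u x - complex.Re (g x))%:C%C
   + 'i%C * (comb k v x - complex.Im (g x))%:C%C.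
  rewrite {1}(complexE (g x)) /F /= comb_cat !rmorphB /=.
  have -> : comb (complex_kernel k) [seq (p.1%:C%C, p.2) | p <- u] x =
      (comb k u x)%:C%C.
    rewrite /comb big_map rmorph_sum; apply: eq_bigr => p _ /=.
    by rewrite rmorphM.
  have -> : comb (complex_kernel k) [seq ('i%C * p.1%:C%C, p.2) | p <- v] x =
      'i%C * (comb k v x)%:C%C.
    rewrite /comb big_map rmorph_sum mulr_sumr; apply: eq_bigr => p _ /=.
    by rewrite rmorphM mulrA.
  ring.
rewrite (le_trans (ler_norm_Re_Im _))// lecR.
have := gu x Cx; have := gv x Cx; rewrite /= distrC => gvx.
rewrite distrC => gux.
set A := comb k u x - _ in gux *; set B := comb k v x - _ in gvx *.
rewrite !(mul0r, mulr0, mul1r, addr0, add0r, subr0); lra.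
Qed.

End FromMetrizable.

End Universal.

(** * From universality to metrizability *)

(** Finite sets are closed in a Hausdorff space, so each point of [C] has a neighbourhood that meets
    [C] in that point only. *)
Lemma finite_within_continuous (X Y : topologicalType) (C : set X) (g : X -> Y) :
  hausdorff_space X -> finite_set C -> {within C, continuous g}.
Proof.
move=> Xh Cfin; apply/subspace_continuousP => x Cx A /nbhs_singleton gxA.
have Ccl : closed (C `\ x).
  apply: accessible_finite_set_closed.1; first exact: hausdorff_accessible.
  exact: finite_setD.
have : nbhs x (~` (C `\ x)).
  by apply: open_nbhs_nbhs; split; [exact: closed_openC|move=> [_]; exact].
apply: filterS => z zC Cz.
by have [->//|zx] := pselect (z = x); case: zC; split.
Qed.

Section UniversalSpd.
Variables (R : realType) (X : topologicalType).

(** If the form vanishes, so does the vector [u], and every [F] in the space satisfies the linear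
    relation [F0] at the points [x i]. Members that nearly take the conjugate values of [c i] there
    violate it unless [c] is zero. *)
Lemma universal_spd (K : X -> X -> R[i]) : hausdorff_space X ->
  universal_kernel K -> spd_kernel K.
Proof.
move=> Xh [Kpd [H [ev [[ev_inj [k [ev_k reprod k_dense]]] _ approx]]]].
split=> // n x c x_inj form0.
pose u : H := \sum_i (c i)^*%C *: k (x i).
have cK z : Num.conj (z^*%C) = z :> R[i] by exact: conjcK.
have kk i j : hdot H (k (x i)) (k (x j)) = K (x j) (x i).
  by rewrite reprod ev_k.
have u0 : u = 0.
  apply/eqP; rewrite -normr_eq0 -sqrf_eq0 hnormE; apply/eqP.
  rewrite -[RHS]form0 /u linear_sumlz exchange_big; apply: eq_bigr => j _ /=.
  rewrite linear_sumr; apply: eq_bigr => i _.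
  rewrite (linearZl_LR (hdot H)) (linearZr_LR (hdot H)) /= kk.
  by rewrite cK mulrCA mulrA.
have F0 (F : H) : \sum_i c i * ev F (x i) = 0.
  transitivity (hdot H F u); last by rewrite u0 linear0r.
  rewrite /u linear_sumr; apply: eq_bigr => i _.
  by rewrite (linearZr_LR (hdot H)) /= cK reprod.
pose C := range x.
have Cfin : finite_set C by exact: finite_image.
have Ccpt : compact C by exact: finite_compact.
pose g (z : X) : R[i]^o := \sum_(i | `[< z = x i >]) (c i)^*%C.
have gx i : g (x i) = (c i)^*%C.
  rewrite /g (big_pred1 i)// => j /=; apply/asboolP/eqP => [/x_inj//|-> //].
pose S := \sum_i `|c i|.
pose Q := \sum_i `|c i| ^+ 2.
(* By [F0], [- Q] is the sum of the [c i] times the approximation errors at [x i]. *)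
have QS (e : R) : 0 < e -> Q <= S * e%:C%C.
  move=> e0.
  have [F Fg] := approx C g e Ccpt (finite_within_continuous Xh Cfin) e0.
  have Fx i : `|ev F (x i) - g (x i)| <= e%:C%C.
    have : ((complex.Re `|ev F (x i) - g (x i)|)%:E <= e%:E)%E.
      by apply: le_trans (ltW Fg); apply: ereal_sup_ubound; exists (x i) => //; exists i.
    by rewrite lee_fin -lecR RRe_real ?normr_real.
  have Q0 : 0 <= Q by apply: sumr_ge0 => i _; rewrite exprn_ge0.
  rewrite -(ger0_norm Q0) -normrN.
  have -> : - Q = \sum_i c i * (ev F (x i) - g (x i)).
    under eq_bigr do rewrite mulrBr gx -sqr_normc.
    by rewrite sumrB F0 sub0r.
  rewrite (le_trans (ler_norm_sum _ _ _))// /S mulr_suml.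
  by apply: ler_sum => i _; rewrite normrM ler_wpM2l.
have S0 : 0 <= S by apply: sumr_ge0.
have /(psumr_eq0P (fun i _ => exprn_ge0 2 (normr_ge0 (c i)))) Q0 : Q = 0.
  apply/eqP; rewrite eq_le sumr_ge0 ?andbT => [|i _]; last by rewrite exprn_ge0.
  apply: (le_all_eps S0) => e e0 _.
  have eR : e = (complex.Re e)%:C%C by rewrite RRe_real// gtr0_real.
  by rewrite eR; apply: QS; rewrite -ltcR -eR.
by move=> i; apply/eqP; rewrite -normr_eq0 -sqrf_eq0 Q0.
Qed.

End UniversalSpd.

(** * Hilbert space embedding of conditionally negative definite kernels *)

Section Metrizable.
Variables (R : realType) (X : Type) (gamma : X -> X -> R).
Local Notation rid := (@idfun R : {rmorphism R -> R}).
Implicit Types s : seq (R * X).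

(** Adding up the coefficients of equal points links formal combinations to [cnd_kernel], which
    speaks of distinct points. *)
Lemma merge_points s : exists (n : nat) (x : 'I_n -> X) (c : 'I_n -> R),
  injective x /\
  forall f : X -> R, \sum_(p <- s) p.1 * f p.2 = \sum_i c i * f (x i).
Proof.
pose t : seq (R * {classic X}) := s; pose pts := undup [seq p.2 | p <- t].
exists (size pts), (tnth (in_tuple pts)),
  (fun i => \sum_(p <- t | p.2 == tnth (in_tuple pts) i) p.1); split.
  exact: (elimT (tuple_uniqP (in_tuple pts)) (undup_uniq _)).
move=> f; rewrite -(big_tnth _ _ pts xpredT
  (fun y : {classic X} => (\sum_(p <- t | p.2 == y) p.1) * f y)).
under [RHS]eq_bigr do rewrite mulr_suml.
rewrite (exchange_big_dep xpredT)//= -[LHS]/(\sum_(p <- t) p.1 * f p.2).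
rewrite [LHS]big_seq [RHS]big_seq.
apply: eq_bigr => p pt; rewrite big_mkcond (bigD1_seq p.2) ?undup_uniq//=.
  by rewrite eqxx big1 ?addr0// => y; rewrite eq_sym => /negPf ->.
by rewrite mem_undup map_f.
Qed.

Hypothesis gamma_cnd : cnd_kernel gamma.

Lemma cnd_form_le0 s : \sum_(p <- s) p.1 = 0 -> kform rid gamma s s <= 0.
Proof.
move=> s0; have [n [x [c [x_inj xc]]]] := merge_points s.
have c0 : \sum_i c i = 0.
  rewrite -[RHS]s0; transitivity (\sum_i c i * 1).
    by apply: eq_bigr => i _; rewrite mulr1.
  by rewrite -(xc (fun=> 1)); apply: eq_bigr => p _; rewrite mulr1.
apply: le_trans (gamma_cnd.2 n x c x_inj c0).
rewrite kformE (eq_bigr (fun q => q.1 * \sum_i c i * gamma q.2 (x i))).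
  rewrite (xc (fun y => \sum_i c i * gamma y (x i))).
  rewrite le_eqVlt; apply/orP; left; apply/eqP; apply: eq_bigr => i _.
  by rewrite mulr_sumr; apply: eq_bigr => j _; rewrite mulrA.
move=> q _; rewrite -xc mulr_sumr; apply: eq_bigr => p _ /=; ring.
Qed.

(** Adjoining [o] with weight [- S] makes the coefficients sum to zero; the form of [gamma] on the
    enlarged combination is [- 2] times the form of the shifted kernel on [s]. *)
Lemma psd_cnd_shift (o : X) : psd_kernel rid
  (fun x y => (gamma x o + gamma o y - gamma x y - gamma o o) / 2).
Proof.
move=> s; pose S := \sum_(p <- s) p.1; pose A := \sum_(p <- s) p.1 * gamma p.2 o.
have := @cnd_form_le0 ((- S, o) :: s); rewrite big_cons addNr => /(_ erefl).
have -> : kform rid gamma ((- S, o) :: s) ((- S, o) :: s) =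
    S * S * gamma o o - 2 * (S * A) + kform rid gamma s s.
  rewrite -cat1s kform_catl !kform_catr !kformE !big_seq1 /=.
  rewrite (eq_bigr (fun q => - S * (q.1 * gamma q.2 o))) => [|q _]; last first.
    by rewrite big_seq1 /=; ring.
  rewrite -mulr_sumr -/A (eq_bigr (fun p => - S * (p.1 * gamma p.2 o)))
    => [|p _]; last by rewrite gamma_cnd.1; ring.
  by rewrite -mulr_sumr -/A; ring.
have e1 : \sum_(q <- s) \sum_(p <- s) p.1 * q.1 * gamma q.2 o = A * S.
  rewrite mulr_suml; apply: eq_bigr => q _; rewrite mulr_sumr.
  by apply: eq_bigr => p _; ring.
have e2 : \sum_(q <- s) \sum_(p <- s) p.1 * q.1 * gamma o p.2 = S * A.
  rewrite mulr_suml; apply: eq_bigr => q _; rewrite mulr_sumr.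
  by apply: eq_bigr => p _; rewrite gamma_cnd.1; ring.
have e3 : \sum_(q <- s) \sum_(p <- s) p.1 * q.1 * gamma o o = S * S * gamma o o.
  rewrite -mulrA mulr_suml; apply: eq_bigr => q _; rewrite mulr_suml mulr_sumr.
  by apply: eq_bigr => p _; ring.
suff -> : kform rid
    (fun x y => (gamma x o + gamma o y - gamma x y - gamma o o) / 2) s s =
    (A * S + S * A - kform rid gamma s s - S * S * gamma o o) / 2.
  by move=> h; lra.
rewrite -e1 -e2 -e3 !kformE -big_split -!sumrB mulr_suml; apply: eq_bigr => q _.
rewrite -big_split -!sumrB mulr_suml; apply: eq_bigr => p _ /=; ring.
Qed.

Lemma cnd_hilbert : exists (H : hilbertSpace (@idfun R)) (h : X -> H),
  forall x y, gamma x y = `|h x - h y| ^+ 2 + gamma x x / 2 + gamma y y / 2.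
Proof.
have [k [kC kpsd kE]] : exists k : X -> X -> R, [/\ forall x y, k y x = k x y,
    psd_kernel rid k & forall x y,
    k x x + k y y - 2 * k x y = gamma x y - gamma x x / 2 - gamma y y / 2].
  (* An empty [X] has no base point [o]; the zero kernel then serves vacuously. *)
  have [[ o _]|X0] := pselect (exists x : X, True); last first.
    exists (fun _ _ => 0); split=> //; last by move=> x; case: X0; exists x.
    by move=> s; rewrite kformE big1// => q _; rewrite big1// => p _; rewrite mulr0.
  exists (fun x y => (gamma x o + gamma o y - gamma x y - gamma o o) / 2); split.
  - by move=> x y; rewrite (gamma_cnd.1 y x) (gamma_cnd.1 o x) (gamma_cnd.1 y o); ring.
  - exact: psd_cnd_shift.
  - by move=> x y; rewrite (gamma_cnd.1 o x) (gamma_cnd.1 o y); field.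
pose D := @PsdKernel (real_scalar R) X k kC kpsd.
exists (rkhs_hilbert D), (@rkhs_point D) => x y.
have dotE u v : hdot (rkhs_hilbert D) (rkhs_point u) (rkhs_point v) = k v u.
  exact: etrans (@rkhs_reproducing D _ v) (@rkhs_pointE D u v).
rewrite sqr_hnormB !hnormE !dotE (kC x y).
by have := kE x y; lra.
Qed.

(** If [h x = h y] with [x <> y], the exponential kernel restricted to these two points is the rank
    one matrix of products of [expR (- (gamma x x / 2))] and [expR (- (gamma y y / 2))]. The
    coefficients [c] are the inverses of these numbers with opposite signs, so the form vanishes on
    them. *)
Lemma spd_metrizable : spd_kernel (complex_kernel (exp_kernel gamma)) ->
  metrizable_kernel gamma.
Proof.
move=> [_ spd]; have [H [h gammaE]] := cnd_hilbert.
exists H, h; split=> // x y hxy; apply: contrapT => xy.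
have gxy : gamma x y = gamma x x / 2 + gamma y y / 2.
  by rewrite gammaE hxy subrr normr0 expr0n add0r.
pose z (i : 'I_2) := if i == 0 then x else y.
pose c (i : 'I_2) : R[i] := if i == 0 then (expR (gamma x x / 2))%:C%C
  else (- expR (gamma y y / 2))%:C%C.
have z_inj : injective z.
  move=> i j; rewrite /z; case: (eqVneq i 0) => [->|i0];
    case: (eqVneq j 0) => [->|j0] // e.
  - by case: (xy (esym e)).
  - by apply/val_inj; case: i i0 {e} => [[|[|]]]//; case: j j0 => [[|[|]]].
have /(_ ord0) : forall i, c i = 0.
  apply: (spd 2 z c z_inj).
  rewrite !big_ord_recl !big_ord0 !addr0.
  have [-> ->] : c ord0 = (expR (gamma x x / 2))%:C%C /\ z ord0 = x by [].
  have [-> ->] : c (lift ord0 ord0) = (- expR (gamma y y / 2))%:C%C /\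
    z (lift ord0 ord0) = y by [].
  have cR (r : R) : Num.conj (r%:C%C : R[i]) = r%:C%C by exact: conjc_real.
  rewrite !cR /complex_kernel -!rmorphM -!rmorphD -[RHS](rmorph0 (real_complex R)).
  congr real_complex_def; rewrite /exp_kernel (gamma_cnd.1 y x) gxy.
  have expE u : expR (- u) = expR (- (u / 2)) * expR (- (u / 2)) :> R.
    by rewrite -expRD -opprD -splitr.
  rewrite (expE (gamma x x)) (expE (gamma y y)) opprD expRD !expRN.
  by field; rewrite !gt_eqF ?expR_gt0.
by rewrite /c /= => /complexI/eqP; rewrite gt_eqF ?expR_gt0.
Qed.

End Metrizable.

Theorem theorem4p1 (R : realType) (X : topologicalType) (gamma : X -> X -> R)
    (X_hausdorff : hausdorff_space X)
    (gamma_continuous : continuous (fun p : X * X => gamma p.1 p.2))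
    (gamma_cnd : cnd_kernel gamma) :
  (spd_kernel (complex_kernel (exp_kernel gamma)) <-> metrizable_kernel gamma)
  /\
  (universal_kernel (complex_kernel (exp_kernel gamma))
     <-> metrizable_kernel gamma).
Proof.
(* Both equivalences come from one cycle: metrizable implies universal, which implies strictly
   positive definite, which implies metrizable. *)
have univ : metrizable_kernel gamma ->
    universal_kernel (complex_kernel (exp_kernel gamma)).
  by move=> [H [h [gammaE h_inj]]]; exact: universal_exp_kernel gammaE h_inj.
split; split.
- exact: spd_metrizable.
- by move=> /univ; exact: universal_spd.
- by move=> /(universal_spd X_hausdorff); exact: spd_metrizable.
- exact: univ.
Qed.
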